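(* Let $F:[0,\infty)\to[0,1]$ be the Minkowski question mark function on the non-negative reals, and for integers $L\ge 0$ let $$m_L=\int_0^\infty\Big(\frac{x}{x+1}\Big)^L\,\mathrm{d}F(x)=2\int_0^1 x^L\,\mathrm{d}F(x).$$ Let $\mathsf{C}=e^{-2\sqrt{\log 2}}$, let $\Psi$ be the $1$-periodic function given by $\Psi(x)=2^{x}(1-F(x))$ for $x\in[0,\infty)$, and let $c_0=\int_0^1\Psi(x)\,\mathrm{d}x$. Then, as $L\to\infty$, $$m_L=\sqrt[4]{4\pi^2\log 2}\cdot c_0\cdot L^{1/4}\,\mathsf{C}^{\sqrt{L}}+O\big(L^{-1/4}\,\mathsf{C}^{\sqrt{L}}\big).$$
   Context: For $x\ge 0$ with regular continued fraction expansion $x=[a_0,a_1,a_2,\dots]$ (finite for rational $x$, in which case the sum below is finite), define $$F([a_0,a_1,a_2,\dots])=1-2^{-a_0}+2^{-(a_0+a_1)}-2^{-(a_0+a_1+a_2)}+\cdots.$$ This $F$ is a continuous, monotone increasing, singular distribution function on $[0,\infty)$, equal to half the classical Minkowski question mark function $?(x)$ on $[0,1]$; it satisfies $2F(x)=F(x-1)+1$ for $x\ge1$ and $2F(x)=F(x/(1-x))$ for $0\le x<1$, so in particular $2^x(1-F(x))$ is $1$-periodic on $[0,\infty)$. The integrals defining $m_L$ are Lebesgue–Stieltjes integrals with respect to $F$. *)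

(* Defs.v *)
From HB Require Import structures.
From mathcomp Require Import all_boot all_order all_algebra.
From mathcomp Require Import all_classical all_reals all_analysis.
From mathcomp Require Import ring lra.

Set Implicit Arguments.
Unset Strict Implicit.
Unset Printing Implicit Defensive.

Import Order.TTheory GRing.Theory Num.Theory.
Import numFieldNormedType.Exports.

Local Open Scope classical_set_scope.
Local Open Scope ring_scope.

Section continued_fraction.
Variable R : realType.
Implicit Types (x y z : R) (n : nat).

(* [None] means that the expansion has already stopped (x rational); stopping
   as soon as a complete quotient is an integer gives the expansion whose last
   partial quotient is at least 2 when there is more than one.  Only x >= 0 is
   meaningful. *)
Fixpoint complete_quotient x n : option R :=
  if n is n'.+1 then
    if complete_quotient x n' is Some y then
      if y == (Num.truncn y)%:R then None else Some (y - (Num.truncn y)%:R)^-1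
    else None
  else Some x.

Definition partial_quotient x n : option nat :=
  omap Num.truncn (complete_quotient x n).

Definition cf_sum x n : nat :=
  (\sum_(k < n.+1) odflt 0 (partial_quotient x k))%N.

Definition mink_term x n : R :=
  if partial_quotient x n is Some _ then (-1) ^+ n.+1 * 2 ^- cf_sum x n else 0.

(* Extended by 0 to the negative reals, so that it is a cumulative function on
   the whole line whose Stieltjes measure is carried by [0, +oo[. *)
Definition mink x : R :=
  if 0 <= x then 1 + limn (series (mink_term x)) else 0.

Local Notation trunc y := ((Num.truncn y)%:R : R).
Local Notation gauss y := ((y - trunc y)^-1).

Local Lemma complete_quotientS x n : complete_quotient x n.+1 =
  if x == trunc x then None else complete_quotient (gauss x) n.
Proof.
elim: n => [//|n IH].
rewrite [LHS]/= -/(complete_quotient x n.+1) IH.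
by case: ifP.
Qed.

Local Lemma partial_quotientS x n : x != trunc x ->
  partial_quotient x n.+1 = partial_quotient (gauss x) n.
Proof.
by move=> xN; rewrite /partial_quotient complete_quotientS (negbTE xN).
Qed.

Local Lemma mink_term0 x : mink_term x 0 = - 2 ^- Num.truncn x.
Proof. by rewrite /mink_term /= /cf_sum big_ord1 /= expr1 mulN1r. Qed.

Local Lemma mink_termS_int x n : x = trunc x -> mink_term x n.+1 = 0.
Proof.
move=> xE; rewrite /mink_term /partial_quotient complete_quotientS.
by rewrite -xE eqxx.
Qed.

Local Lemma mink_termS x n : x != trunc x ->
  mink_term x n.+1 = - (2 ^- Num.truncn x * mink_term (gauss x) n).
Proof.
move=> xN; rewrite /mink_term partial_quotientS //.
case: partial_quotient => [_|]; last by rewrite mulr0 oppr0.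
have -> : cf_sum x n.+1 = (Num.truncn x + cf_sum (gauss x) n)%N.
  rewrite /cf_sum big_ord_recl; congr addn.
  by apply: eq_bigr => i _; rewrite lift0 partial_quotientS.
by rewrite exprS exprD invfM; ring.
Qed.

Local Lemma gauss_gt1 x : 0 <= x -> x != trunc x -> 1 < gauss x.
Proof.
move=> x0 xN; have /andP[h1 h2] := truncn_itv x0.
have t0 : 0 < x - trunc x by rewrite subr_gt0 lt_neqAle eq_sym xN.
by rewrite invf_gt1 // ltrBlDl natr1.
Qed.

Local Lemma half_exp n : 2 ^- n = (2^-1 : R) ^+ n.
Proof. by rewrite exprVn. Qed.

Local Lemma half_le m n : (m <= n)%N -> 2 ^- n <= 2 ^- m :> R.
Proof. by move=> mn; rewrite !half_exp ler_wiXn2l //; lra. Qed.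

Local Lemma half_ge0 n : 0 <= 2 ^- n :> R.
Proof. by rewrite invr_ge0 exprn_ge0. Qed.

Local Lemma half_le1 n : 2 ^- n <= 1 :> R.
Proof. by have := half_le (leq0n n); rewrite expr0 invr1. Qed.

Local Lemma mink_term_le n x : 0 <= x ->
  `|mink_term x n| <= 2 ^- (n + Num.truncn x).
Proof.
elim: n x => [|n IH] x x0.
  by rewrite mink_term0 normrN ger0_norm // half_ge0.
have [xE|xN] := eqVneq x (trunc x); first by rewrite mink_termS_int // normr0 half_ge0.
have y1 := gauss_gt1 x0 xN.
rewrite mink_termS // normrN normrM (ger0_norm (half_ge0 _)).
apply: (@le_trans _ _ (2 ^- Num.truncn x * 2 ^- n.+1)).
  rewrite ler_wpM2l ?half_ge0 //; apply: le_trans (IH _ _) _.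
    by rewrite ltW // (lt_trans _ y1).
  by rewrite half_le // -addn1 leq_add2l truncn_gt0 ltW.
by rewrite -invfM -exprD addnC.
Qed.

Local Lemma is_cvg_mink x : 0 <= x -> cvgn (series (mink_term x)).
Proof.
move=> x0; apply: normed_cvg.
apply: (@series_le_cvg _ _ (geometric 1 (2^-1 : R))) => [n|n|n|].
- exact: normr_ge0.
- by rewrite /= mul1r -half_exp half_ge0.
- rewrite /= mul1r -half_exp (le_trans (mink_term_le _ x0)) //.
  by rewrite half_le // leq_addr.
- by apply: is_cvg_geometric_series; rewrite ger0_norm; lra.
Qed.

Local Definition psum x n : R := 1 + series (mink_term x) n.

Local Lemma psum0 x : psum x 0 = 1.
Proof. by rewrite /psum /series /= big_geq // addr0. Qed.

Local Lemma psumS_int x n : x = trunc x -> psum x n.+1 = 1 - 2 ^- Num.truncn x.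
Proof.
move=> xE; rewrite /psum /series /= big_nat_recl // mink_term0 big1 ?addr0 //.
by move=> i _; exact: mink_termS_int.
Qed.

Local Lemma psumS x n : x != trunc x ->
  psum x n.+1 = 1 - 2 ^- Num.truncn x * psum (gauss x) n.
Proof.
move=> xN; rewrite /psum /series /= big_nat_recl // mink_term0.
under eq_bigr do rewrite mink_termS //.
by rewrite sumrN -mulr_sumr; ring.
Qed.

Local Lemma psum_itv n x : 0 <= x -> 1 - 2 ^- Num.truncn x <= psum x n <= 1.
Proof.
elim: n x => [|n IH] x x0; first by rewrite psum0 lexx andbT gerBl half_ge0.
have [xE|xN] := eqVneq x (trunc x).
  by rewrite psumS_int // lexx gerBl half_ge0.
have y1 := gauss_gt1 x0 xN.
have y0 : 0 <= gauss x by rewrite ltW // (lt_trans _ y1).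
have /andP[h1 h2] := IH _ y0.
rewrite psumS // lerD2l lerN2 gerBl ler_piMr ?half_ge0 //=.
rewrite mulr_ge0 ?half_ge0 // (le_trans _ h1) // subr_ge0.
exact: half_le1.
Qed.

Local Lemma psum_ge_half n x : 1 <= x -> 2^-1 <= psum x n.
Proof.
move=> x1; have x0 : 0 <= x by rewrite (le_trans _ x1).
have /andP[h _] := psum_itv n x0.
have : 2 ^- Num.truncn x <= 2 ^- 1 :> R by rewrite half_le // truncn_gt0.
rewrite expr1; lra.
Qed.

Local Lemma truncn_homo x y : 0 <= x -> x <= y -> (Num.truncn x <= Num.truncn y)%N.
Proof.
move=> x0 xy; rewrite truncn_ge_nat ?(le_trans x0) //.
by rewrite (le_trans _ xy) // truncn_le.
Qed.

Local Lemma psum_homo n x y : 0 <= x -> x <= y -> psum x n <= psum y n.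
Proof.
elim: n x y => [|n IH] x y x0 xy; first by rewrite !psum0.
have y0 := le_trans x0 xy.
have := truncn_homo x0 xy; rewrite leq_eqVlt => /orP[/eqP txy|txy]; last first.
  apply: (@le_trans _ _ (1 - 2 ^- Num.truncn y)); last first.
    by have /andP[] := psum_itv n.+1 y0.
  have [xE|xN] := eqVneq x (trunc x).
    by rewrite psumS_int // lerD2l lerN2 half_le // ltnW.
  rewrite psumS // lerD2l lerN2.
  apply: (@le_trans _ _ (2 ^- (Num.truncn x).+1)); first by rewrite half_le.
  rewrite exprSr invfM ler_wpM2l ?half_ge0 // psum_ge_half // ltW //.
  exact: gauss_gt1.
have [yE|yN] := eqVneq y (trunc y).
  have <- : x = y by apply/le_anti; rewrite xy {1}yE -txy truncn_le x0.
  by [].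
rewrite (psumS _ yN) -txy.
have y1 := gauss_gt1 y0 yN.
have gy0 : 0 <= gauss y by rewrite ltW // (lt_trans _ y1).
have [xE|xN] := eqVneq x (trunc x).
  rewrite psumS_int // lerD2l lerN2 ler_piMr ?half_ge0 //.
  by have /andP[] := psum_itv n gy0; rewrite -txy.
rewrite psumS // lerD2l lerN2 ler_wpM2l ?half_ge0 //; apply: IH.
  by rewrite txy.
rewrite lef_pV2 ?posrE ?lerD2r //.
- by rewrite subr_gt0 lt_neqAle txy eq_sym yN truncn_le y0.
- by rewrite subr_gt0 lt_neqAle eq_sym xN truncn_le x0.
Qed.

Local Lemma psum_cvg x : 0 <= x -> psum x @ \oo --> mink x.
Proof.
move=> x0; rewrite /mink x0 /psum.
by apply: cvgD; [exact: cvg_cst|exact: is_cvg_mink].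
Qed.

Lemma mink_nat n : mink n%:R = 1 - 2 ^- n.
Proof.
have x0 : 0 <= n%:R :> R by [].
have h : (fun k => psum n%:R k.+1) @ \oo --> mink n%:R.
  by rewrite (@cvg_shiftS _ (psum n%:R)); exact: psum_cvg.
have e : (fun k => psum n%:R k.+1) = cst (1 - 2 ^- n).
  by apply/funext => k; rewrite psumS_int ?natrK.
by rewrite e in h; rewrite -(cvg_lim _ h) // lim_cst.
Qed.

Lemma mink_recl x : 0 <= x -> x != trunc x ->
  mink x = 1 - 2 ^- Num.truncn x * mink (gauss x).
Proof.
move=> x0 xN.
have y1 := gauss_gt1 x0 xN.
have y0 : 0 <= gauss x by rewrite ltW // (lt_trans _ y1).
have h : (fun k => psum x k.+1) @ \oo --> mink x.
  by rewrite (@cvg_shiftS _ (psum x)); exact: psum_cvg.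
have e : (fun k => psum x k.+1) =
    (fun k => 1 - 2 ^- Num.truncn x * psum (gauss x) k).
  by apply/funext => k; rewrite psumS.
rewrite e in h; rewrite -(cvg_lim _ h) //; apply: cvg_lim => //.
apply: cvgB; first exact: cvg_cst.
by apply: cvgM; [exact: cvg_cst|exact: psum_cvg].
Qed.

Lemma mink_itv x : 0 <= x -> 1 - 2 ^- Num.truncn x <= mink x <= 1.
Proof.
move=> x0; have h := psum_cvg x0; apply/andP; split.
- rewrite -(cvg_lim _ h) //; apply: limr_ge; first by apply/cvg_ex; exists (mink x).
  by apply: nearW => n; have /andP[] := psum_itv n x0.
- rewrite -(cvg_lim _ h) //; apply: limr_le; first by apply/cvg_ex; exists (mink x).
  by apply: nearW => n; have /andP[] := psum_itv n x0.
Qed.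

Local Lemma mink_lt0 x : x < 0 -> mink x = 0.
Proof. by move=> x0; rewrite /mink leNgt x0. Qed.

Lemma mink_nondecreasing : nondecreasing mink.
Proof.
move=> x y xy.
have [x0|x0] := leP 0 x; last first.
  rewrite (mink_lt0 x0); have [y0|/mink_lt0 -> //] := leP 0 y.
  have /andP[+ _] := mink_itv y0; apply: le_trans.
  by rewrite subr_ge0 half_le1.
have y0 := le_trans x0 xy.
rewrite -(cvg_lim _ (psum_cvg x0)) // -(cvg_lim _ (psum_cvg y0)) //.
apply: ler_lim.
- by apply/cvg_ex; exists (mink x); exact: psum_cvg.
- by apply/cvg_ex; exists (mink y); exact: psum_cvg.
- by apply: nearW => n; exact: psum_homo.
Qed.

Local Lemma mink0 : mink 0 = 0.
Proof. by rewrite (mink_nat 0) expr0 invr1 subrr. Qed.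

Local Lemma mink_between a x : a%:R < x < a.+1%:R ->
  mink x = 1 - 2 ^- a * mink (x - a%:R)^-1.
Proof.
move=> /andP[ax xa].
have tx : Num.truncn x = a by apply: truncn_def; rewrite ltW.
rewrite mink_recl ?tx //; first by rewrite ltW // (le_lt_trans _ ax).
by rewrite gt_eqF.
Qed.

Local Lemma mink_near_right a n : \forall z \near (a%:R : R),
  a%:R <= z -> `|mink z - mink a%:R| <= 2 ^- n.
Proof.
near=> z => az; have [->|aNz] := eqVneq z a%:R.
  by rewrite subrr normr0 half_ge0.
have az' : a%:R < z by rewrite lt_neqAle eq_sym aNz.
have za : z < a.+1%:R.
  near: z; apply: lt_nbhsl; by rewrite ltr_nat.
have zn : z < a%:R + n.+1%:R^-1.
  near: z; apply: lt_nbhsl; by rewrite ltrDl invr_gt0.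
rewrite (@mink_between a) ?az' // mink_nat.
set y := (z - _)^-1.
have yn : n.+1%:R <= y.
  rewrite /y -[X in X <= _]invrK lef_pV2 ?posrE ?invr_gt0 ?subr_gt0 //.
  by rewrite lerBlDl ltW.
have y0 : 0 <= y by rewrite (le_trans _ yn).
have /andP[h1 h2] := mink_itv y0.
have h3 : 2 ^- Num.truncn y <= 2 ^- n :> R.
  by rewrite half_le // ltnW // truncn_ge_nat.
have -> : 1 - 2 ^- a * mink y - (1 - 2 ^- a) = 2 ^- a * (1 - mink y) by ring.
rewrite ger0_norm ?mulr_ge0 ?half_ge0 ?subr_ge0 //.
rewrite -[leRHS]mul1r ler_pM ?half_ge0 ?half_le1 ?subr_ge0 //; lra.
Unshelve. all: by end_near. Qed.

Local Lemma gauss_cvg a x : a%:R < x ->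
  (fun z => (z - a%:R)^-1) @ x --> (x - a%:R)^-1.
Proof.
move=> ax; apply: cvgV; first by rewrite subr_eq0 gt_eqF.
by apply: cvgB; [exact: cvg_id|exact: cvg_cst].
Qed.

Local Lemma mink_near_nat a n : \forall z \near (a%:R : R),
  `|mink z - mink a%:R| <= 2 ^- n.
Proof.
case: a => [|b].
  near=> z; have [z0|z0] := leP 0 z; last first.
    by rewrite mink_lt0 // mink0 subrr normr0 half_ge0.
  by move: z0; near: z; exact: mink_near_right.
near=> z; have [bz|zb] := leP b.+1%:R z.
  by move: bz; near: z; exact: mink_near_right.
have bz : b%:R < z.
  by near: z; apply: lt_nbhsr; rewrite ltr_nat.
rewrite (@mink_between b) ?bz // mink_nat.
set y := (z - _)^-1.
have y1 : 1 <= y.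
  by rewrite /y invf_ge1 ?subr_gt0 // lerBlDl natr1 ltW.
have h : 1 <= y -> `|mink y - mink 1| <= 2 ^- n.
  rewrite /y; near: z.
  have c : (fun z : R => (z - b%:R)^-1) @ (b.+1%:R : R) --> (1 : R).
    have := @gauss_cvg b b.+1%:R; rewrite -[in X in _ --> X]natr1.
    by rewrite [X in X - _]addrC addrK invr1; apply; rewrite ltr_nat.
  apply: (c (fun y => 1 <= y -> `|mink y - mink 1| <= 2 ^- n)).
  exact: (mink_near_right 1).
have := h y1; rewrite (mink_nat 1) expr1 exprSr invfM => {}h.
have -> : 1 - 2 ^- b * mink y - (1 - 2 ^- b * 2^-1) =
  - (2 ^- b * (mink y - (1 - 2^-1))) by field; rewrite expf_neq0.
rewrite normrN normrM ger0_norm ?half_ge0 //.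
by rewrite -[leRHS]mul1r ler_pM ?half_ge0 ?half_le1.
Unshelve. all: by end_near. Qed.

Local Lemma mink_near n x : 0 <= x -> \forall z \near x,
  `|mink z - mink x| <= 2 ^- n.
Proof.
have step (k a : nat) (w : R) : a%:R < w < a.+1%:R -> (\forall z \near (w - a%:R)^-1,
    `|mink z - mink (w - a%:R)^-1| <= 2 ^- k) ->
    \forall z \near w, `|mink z - mink w| <= 2 ^- (a + k).
  move=> /andP[aw wa] H; near=> z.
  have az : a%:R < z by near: z; exact: lt_nbhsr.
  have za : z < a.+1%:R by near: z; exact: lt_nbhsl.
  rewrite (@mink_between a z) ?az // (@mink_between a w) ?aw //.
  rewrite [X in `|X|](_ : _ =
    - (2 ^- a * (mink (z - a%:R)^-1 - mink (w - a%:R)^-1))); last by ring.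
  rewrite normrN normrM ger0_norm ?half_ge0 // exprD invfM.
  rewrite ler_wpM2l ?half_ge0 //; near: z.
  exact: (gauss_cvg aw H).
have itv (w : R) : 0 <= w -> w != trunc w -> trunc w < w < (Num.truncn w).+1%:R.
  move=> w0 wN; have /andP[h ->] := truncn_itv w0.
  by rewrite lt_neqAle eq_sym wN h.
have main (w : R) : 1 <= w -> \forall z \near w, `|mink z - mink w| <= 2 ^- n.
  elim: n w => [|k IH] w w1; have w0 : 0 <= w by rewrite (le_trans _ w1).
    near=> z; rewrite expr0 invr1.
    have /andP[h1 h2] := mink_itv w0.
    have h3 : 0 <= mink w by rewrite (le_trans _ h1) // subr_ge0 half_le1.
    have [z0|/mink_lt0 ->] := leP 0 z; last by rewrite sub0r normrN ger0_norm.
    have /andP[h1' h2'] := mink_itv z0.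
    have h3' : 0 <= mink z by rewrite (le_trans _ h1') // subr_ge0 half_le1.
    by rewrite ler_norml; lra.
  have [wE|wN] := eqVneq w (trunc w); first by rewrite wE; exact: mink_near_nat.
  have H := step k _ _ (itv _ w0 wN) (IH _ (ltW (gauss_gt1 w0 wN))).
  apply: filterS H => z /le_trans; apply.
  by rewrite half_le // -add1n leq_add2r truncn_gt0.
move=> x0; have [xE|xN] := eqVneq x (trunc x).
  by rewrite xE; exact: mink_near_nat.
have H := step n _ _ (itv _ x0 xN) (main _ (ltW (gauss_gt1 x0 xN))).
apply: filterS H => z /le_trans; apply.
by rewrite half_le // leq_addl.
Unshelve. all: by end_near. Qed.

Lemma mink_continuous : continuous mink.
Proof.
move=> x; have [x0|x0] := leP 0 x; last first.
  apply/cvgrPdist_le => /= e e0; near=> z.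
  rewrite !mink_lt0 ?subrr ?normr0 ?ltW //.
  by near: z; exact: lt_nbhsl.
apply/cvgrPdist_le => /= e e0.
have [n ne] : exists n, 2 ^- n <= e.
  have : (fun n => (2^-1 : R) ^+ n) @ \oo --> 0 by apply: cvg_expr; rewrite ger0_norm; lra.
  move=> /cvgrPdist_le /(_ _ e0) [n _ /(_ n (leqnn n))] /=.
  by rewrite sub0r normrN -half_exp ger0_norm ?half_ge0 //; exists n.
near=> z; rewrite distrC (le_trans _ ne) //; near: z; exact: mink_near.
Unshelve. all: by end_near. Qed.

HB.instance Definition _ := isCumulative.Build R _ R mink
  mink_nondecreasing (right_continuousW mink_continuous).

Definition mink_moment (L : nat) : R :=
  \int[lebesgue_stieltjes_measure mink]_(x in `[0, +oo[) (x / (x + 1)) ^+ L.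

(* Only x >= 0 is meaningful; on negative reals the formula is not periodic. *)
Definition Psi x : R := 2 `^ x * (1 - mink x).

Lemma Psi_periodic x : 0 <= x -> Psi (x + 1) = Psi x.
Proof.
move=> x0; rewrite /Psi; suff -> : mink (x + 1) = (1 + mink x) / 2.
  by rewrite powRD ?pnatr_eq0 ?implybT // powRr1 //; field.
have tx : Num.truncn (x + 1) = (Num.truncn x).+1.
  apply: truncn_def; have /andP[h1 h2] := truncn_itv x0.
  by rewrite -(natr1 (Num.truncn x)) -(natr1 (Num.truncn x).+1) lerD2r h1 ltrD2r.
have [->|xN] := eqVneq x (trunc x).
  by rewrite natr1 !mink_nat exprSr invfM; field; rewrite expf_neq0.
have x1N : x + 1 != trunc (x + 1) by rewrite tx -natr1 (inj_eq (addIr _)).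
rewrite (mink_recl x0) // (mink_recl _ x1N) ?addr_ge0 // tx.
have -> : x + 1 - (Num.truncn x).+1%:R = x - trunc x by rewrite -natr1; ring.
by rewrite exprSr invfM; field; rewrite expf_neq0.
Qed.

Definition Psi_mean : R := \int[lebesgue_measure]_(x in `[0, 1]) Psi x.

Definition mink_C : R := expR (- (2 * Num.sqrt (ln 2))).

End continued_fraction.

(* Main.v *)
Require Import Defs.
From HB Require Import structures.
From mathcomp Require Import all_boot all_order all_algebra.
From mathcomp Require Import all_classical all_reals all_analysis.
From mathcomp Require Import measurable_realfun.
From mathcomp Require Import ring lra.

Set Implicit Arguments.
Unset Strict Implicit.
Unset Printing Implicit Defensive.

Import Order.TTheory GRing.Theory Num.Theory.
Import numFieldNormedType.Exports.

Local Open Scope classical_set_scope.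
Local Open Scope ring_scope.

(* Write F = mink, lam = ln 2, f(x) = (x/(x+1))^L exp(-lam x).  Since
   1 - F(n + t) = 2^-n (1 - F(t)), cutting the half-line at the integers gives
   m_L = int_[0,1[ 2^t S(t) dF(t) with S(t) = sum_n f(n + t), while Tonelli gives
   int_[0,1[ 2^t dF(t) = lam c_0.  So it suffices to show that S(t) equals
   (4 pi^2 / lam^3)^(1/4) L^(1/4) C^(sqrt L) up to O(L^(-1/4) C^(sqrt L)),
   uniformly in t.

   This is done without computing an integral of f: if A' dominates (or is
   dominated by) f, then the mean value theorem applied to sum_n A(n + t) compares
   A(N) - A(0) with sum_n f(n + xi) for one xi in [0,1], and the oscillation of
   t |-> sum_n f(n + t) is controlled by the total variation of f'.

   With L = q^4, lam = l^4 and w = (l/q) sqrt(x + 1/2), f(x) is nearly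
   sqrt 2 exp(-2 (lq)^2) exp(-(lq)^2 (w - 1/w)^2), because
   ln((x+1)/x) = 1/y + O(1/y^3) for y = x + 1/2.  For such profiles, explicit
   comparison functions A are built from the Gaussian distribution function of
   lq (w - 1/w); the needed inequalities between derivatives reduce to
   2w <= w^2 + 1 and similar ones. *)

(** * The Stieltjes measure of the Minkowski function *)

Lemma exists_half_exp_le (R : realType) (e : R) : 0 < e -> exists n, 2 ^- n <= e.
Proof.
move=> e0.
have : (fun n => (2^-1 : R) ^+ n) @ \oo --> 0.
  by apply: cvg_expr; rewrite ger0_norm; lra.
move=> /cvgrPdist_le /(_ _ e0) [n _ /(_ n (leqnn n))] /=.
by rewrite sub0r normrN exprVn ger0_norm ?invr_ge0 ?exprn_ge0 //; exists n.
Qed.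

(** The restriction [mrestr mu mD] gives no mass to the complement of [D] and agrees with [mu]
    inside. This turns integrals over a set into integrals over the whole line, where pushforwards
    can be used. *)
Lemma ge0_integral_mrestr d (T : measurableType d) (R : realType)
    (mu : {measure set T -> \bar R}) (D : set T) (mD : measurable D)
    (f : T -> \bar R) : measurable_fun setT f -> (forall x, 0 <= f x)%E ->
  (\int[mrestr mu mD]_x f x = \int[mu]_(x in D) f x)%E.
Proof.
move=> mf f0; rewrite -(setUv D) ge0_integral_setU //=; last 3 first.
- exact: measurableC.
- by rewrite setUv.
- by rewrite disj_set2E setICr.
rewrite [X in (_ + X)%E](_ : _ = 0%E) ?adde0; last first.
  rewrite -(@integral_measure_zero _ _ R (~` D) f).
  apply: eq_measure_integral => A mA AD.
  rewrite /= /mrestr (_ : A `&` D = set0) ?measure0 //.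
  by apply/disjoints_subset.
by apply: eq_measure_integral => A mA AD; rewrite /= /mrestr setIidl.
Qed.

Section mink_measure.
Variable R : realType.
Local Notation F := (@mink R).
Local Notation mu := (lebesgue_stieltjes_measure (@mink R)).

Lemma mink_le1 (x : R) : F x <= 1.
Proof.
have [x0|x0] := leP 0 x; first by have /andP[] := mink_itv x0.
by rewrite Defs.mink_lt0.
Qed.

Lemma mink_ge0 (x : R) : 0 <= F x.
Proof.
have [x0|x0] := leP 0 x; last by rewrite Defs.mink_lt0.
have /andP[+ _] := mink_itv x0; apply: le_trans.
by rewrite subr_ge0; exact: Defs.half_le1.
Qed.

Lemma mink_eq0 (x : R) : x <= 0 -> F x = 0.
Proof.
move=> x0; apply/le_anti; rewrite mink_ge0 andbT.
by rewrite (le_trans (mink_nondecreasing x0)) // (mink_nat R 0) expr0 invr1 subrr.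
Qed.

Lemma cvg_minkNy : F @ -oo --> (0 : R).
Proof.
apply: cvg_near_cst; near=> x; apply: mink_eq0.
by near: x; exact: nbhs_ninfty_le.
Unshelve. all: by end_near. Qed.

Lemma cvg_minky : F @ +oo --> (1 : R).
Proof.
apply/cvgrPdist_le => /= e e0.
have [n ne] := exists_half_exp_le e0.
near=> x.
have : F n%:R <= F x.
  by apply: mink_nondecreasing; near: x; exact: nbhs_pinfty_ge.
have := mink_le1 x; rewrite mink_nat.
rewrite ler_norml; lra.
Unshelve. all: by end_near. Qed.

(** The limits 0 and 1 at the two infinities make [mu] a probability measure, so that complements
    and total mass come from the general theory. *)
HB.instance Definition _ :=
  isCumulativeBounded.Build R 0 1 (@mink R) cvg_minkNy cvg_minky.

Lemma mink_measure_setT : mu setT = 1%E.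
Proof. exact: probability_setT. Qed.

Lemma mink_measure_Nyc (a : R) : mu `]-oo, a] = (F a)%:E.
Proof. by rewrite -(cdf_lebesgue_stieltjes_id (@mink R)) /cdf /distribution /pushforward preimage_id. Qed.

(** Since F is continuous, [mu] has no atoms and the type of the endpoint is irrelevant. For the
    open ray, F(b) is at most its mass for every b < a, and b tends to a from the left. *)
Lemma mink_measure_Ny (x : bool) (a : R) :
  mu [set` Interval -oo%O (BSide x a)] = (F a)%:E.
Proof.
case: x; last exact: mink_measure_Nyc.
apply/le_anti/andP; split.
  rewrite -mink_measure_Nyc; apply: le_measure; rewrite ?inE //.
  by apply: subset_itvl; rewrite bnd_simp.
have h (b : R) : b < a -> ((F b)%:E <= mu `]-oo, a[)%E.
  move=> ba; rewrite -mink_measure_Nyc; apply: le_measure; rewrite ?inE //.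
  by apply: subset_itvl; rewrite bnd_simp.
have fin : mu `]-oo, a[ \is a fin_num.
  by rewrite fin_num_measure.
rewrite -(fineK fin) lee_fin.
have c : F x @[x --> a^'-] --> F a.
  by apply: cvg_at_left_filter; exact: mink_continuous.
apply: (cvgr_to_le c); near=> b; rewrite -lee_fin fineK //; apply: h.
by near: b; exact: nbhs_left_lt.
Unshelve. all: by end_near. Qed.

Lemma mink_measure_y (x : bool) (a : R) :
  mu [set` Interval (BSide x a) +oo%O] = (1 - F a)%:E.
Proof.
rewrite -setCitvl probability_setC // EFinB -(mink_measure_Ny x).
by [].
Qed.

Lemma mink_measure_itv (x y : bool) (a b : R) : a < b ->
  mu [set` Interval (BSide x a) (BSide y b)] = (F b - F a)%:E.
Proof.
move=> ab; rewrite set_itv_splitD measureD //= ?mink_measure_y.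
  rewrite setIidr ?mink_measure_y -?EFinB; first by congr EFin; ring.
  by apply: subset_itvr; case: x; case: y; rewrite bnd_simp // ltW.
by rewrite ltry.
Qed.

(** A change of variables for dF: if the image under [T] of [mu] on [D] and [c] times [mu] on [E]
    agree on all rays, they agree as measures. It is applied to the shift x - n and to x / (x +
    1). *)
Lemma mink_measure_pushforward (T : R -> R) (D E : set R) (c : {nonneg R}) :
  measurable_fun setT T -> measurable D -> measurable E ->
  (forall a, mu (D `&` T @^-1` `]a, +oo[) = c%:num%:E * mu (E `&` `]a, +oo[))%E ->
  forall h : R -> R, measurable_fun setT h -> (forall x, 0 <= h x) ->
  (\int[mu]_(x in D) (h (T x))%:E = c%:num%:E * \int[mu]_(x in E) (h x)%:E)%E.
Proof.
move=> mT mD mE H h mh h0.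
have mh' : measurable_fun setT (EFin \o h) by exact/measurable_EFinP.
have mTa a : measurable (T @^-1` `]a, +oo[).
  by rewrite -[X in measurable X]setTI; exact: mT.
pose TR := measurableTypeR R.
pose m1' : {measure set TR -> \bar R} :=
  pushforward (mrestr mu mD) (T : TR -> TR).
pose m1 := m1' mT.
pose m2 : {measure set TR -> \bar R} := mscale c (mrestr mu mE).
transitivity (\int[m1]_x (h x)%:E)%E.
  rewrite ge0_integral_pushforward //; last first.
    by move=> x _; rewrite lee_fin.
  rewrite preimage_setT.
  apply/esym; apply: ge0_integral_mrestr => [|x]; last by rewrite lee_fin.
  by apply: measurableT_comp => //; exact: measurableT_comp.
transitivity (\int[m2]_x (h x)%:E)%E; last first.
  rewrite ge0_integral_mscale //; last by move=> x _; rewrite lee_fin.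
  by rewrite ge0_integral_mrestr // => x; rewrite lee_fin.
apply: (eq_measure_integral m2) => A mA _.
(* The open right rays generate the Borel sets, are stable under intersection, exhaust the line
   along the integers, and have finite mass. *)
apply: (@measure_unique _ R TR (@RGenOInfty.G R) (fun n => `](- n%:R)%R, +oo[%classic)) => //.
- exact: RGenOInfty.measurableE.
- move=> _ _ [a ->] [b ->]; exists (Num.max a b).
  by apply/seteqP; split=> x /=; rewrite !in_itv /= !andbT gt_max => /andP.
- by move=> n; exists (- n%:R).
- apply/seteqP; split=> // x _; exists (Num.truncn `|x|).+1 => //=.
  rewrite in_itv /= andbT ltrNl (le_lt_trans (ler_norm _)) // normrN.
  by have /andP[] := truncn_itv (normr_ge0 x).
- move=> _ [a ->]; rewrite /m1 /m2 /= /mscale /pushforward /= /mrestr.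
  by rewrite setIC H setIC.
- move=> n; rewrite /m1 /= /pushforward /= /mrestr (@le_lt_trans _ _ (mu setT)) //.
    apply: le_measure; rewrite ?inE //=; apply: measurableI => //.
    exact: mTa.
  by rewrite mink_measure_setT ltry.
Qed.

(** * Functional equations of F and the resulting changes of variables *)

Lemma mink_addr1 (x : R) : 0 <= x -> F (x + 1) = (1 + F x) / 2.
Proof.
move=> x0; have := Psi_periodic x0; rewrite /Psi powRD ?pnatr_eq0 ?implybT //.
have p0 : 2 `^ x != 0 :> R by rewrite gt_eqF // powR_gt0.
rewrite powRr1 // -mulrA => /(mulfI p0); lra.
Qed.

Lemma mink_addn (x : R) n : 0 <= x -> F (x + n%:R) = 1 - 2 ^- n * (1 - F x).
Proof.
move=> x0; elim: n => [|n IH]; first by rewrite addr0 expr0 invr1; ring.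
rewrite -natr1 addrA mink_addr1 ?addr_ge0 // IH exprSr invfM; field.
by rewrite expf_neq0.
Qed.

(** For x < 1 this is the continued fraction recursion with first partial quotient 0; the statement
    is symmetric in x and 1/x. *)
Lemma mink_inv (x : R) : 0 < x -> F x = 1 - F x^-1.
Proof.
have lt1 (y : R) : 0 < y -> y < 1 -> F y = 1 - F y^-1.
  by move=> y0 y1; rewrite (@Defs.mink_between _ 0) ?y0 ?y1 // subr0 expr0 invr1 mul1r.
move=> x0; have [x1|x1|->] := ltgtP x 1; first exact: lt1.
  by rewrite (lt1 x^-1) ?invr_gt0 ?invf_lt1 // invrK; ring.
by rewrite invr1 (mink_nat R 1); field.
Qed.

(** After inverting both arguments by [mink_inv], they differ by the shift by 1. *)
Lemma mink_half (x : R) : 0 <= x -> x < 1 -> F (x / (1 - x)) = 2 * F x.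
Proof.
rewrite le_eqVlt => /predU1P[<- _|x0 x1]; first by rewrite mul0r mink_eq0 // mulr0.
have y0 : 0 < x / (1 - x) by rewrite divr_gt0 // subr_gt0.
rewrite (mink_inv y0) (mink_inv x0).
have -> : x^-1 = (x / (1 - x))^-1 + 1.
  by rewrite invf_div; field; rewrite gt_eqF.
by rewrite mink_addr1 ?invr_ge0 ?ltW //; field.
Qed.

(** By 1 - F(a + n) = 2^-n (1 - F(a)), the map x - n carries [mu] on the n-th cell to 2^-n times
    [mu] on the unit cell. *)
Lemma mink_measure_shift n (h : R -> R) :
  measurable_fun setT h -> (forall x, 0 <= h x) ->
  (\int[mu]_(x in `[n%:R%R, n.+1%:R%R[) (h x)%:E =
   (2 ^- n)%:E * \int[mu]_(x in `[0%R, 1%R[) (h (x + n%:R))%:E)%E.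
Proof.
move=> mh h0.
have c0 : 0 <= 2 ^- n :> R by rewrite invr_ge0 exprn_ge0.
rewrite -(@mink_measure_pushforward (fun x => x - n%:R) `[n%:R, n.+1%:R[ `[0, 1[ (NngNum c0)
  _ _ _ _ (fun x => h (x + n%:R))) //=.
- by under [RHS]eq_integral do rewrite subrK.
- by apply: measurable_funB.
(* The ray from a contains the unit cell, cuts it, or misses it. *)
- move=> a; have [a0|a0] := ltP a 0.
    rewrite (_ : _ `&` _ = `[n%:R, n.+1%:R[%classic); last first.
      apply/seteqP; split=> x /=; rewrite !in_itv /= ?andbT; first by case.
      by move=> /andP[h1 h2]; rewrite h1 h2; split=> //; lra.
    rewrite (_ : _ `&` _ = `[0, 1[%classic); last first.
      apply/seteqP; split=> x /=; rewrite !in_itv /= ?andbT; first by case.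
      by move=> /andP[h1 h2]; rewrite h1 h2; split=> //; lra.
    rewrite !mink_measure_itv ?ltr_nat // -EFinM; congr EFin.
    rewrite !mink_nat (mink_nat R 1) (mink_nat R 0) expr0 exprSr invfM; field.
    by rewrite expf_neq0.
  have [a1|a1] := ltP a 1.
    rewrite (_ : _ `&` _ = `](a + n%:R), n.+1%:R[%classic); last first.
      apply/seteqP; split=> x /=; rewrite !in_itv /= ?andbT -natr1.
        by move=> [/andP[h1 h2] h3]; rewrite h2 andbT; lra.
      by move=> /andP[h1 h2]; rewrite h2 andbT; split; lra.
    rewrite (_ : _ `&` _ = `]a, 1[%classic); last first.
      apply/seteqP; split=> x /=; rewrite !in_itv /= ?andbT.
        by move=> [/andP[h1 h2] h3]; rewrite h2 h3.
      by move=> /andP[h1 h2]; rewrite h2 h1 andbT; split=> //; lra.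
    rewrite !mink_measure_itv //; last by rewrite -natr1; lra.
    rewrite -EFinM; congr EFin.
    rewrite mink_addn // mink_nat (mink_nat R 1) exprSr invfM; field.
    by rewrite expf_neq0.
  rewrite (_ : _ `&` _ = set0); last first.
    apply/seteqP; split=> x //=; rewrite !in_itv /= ?andbT -natr1.
    by move=> [/andP[h1 h2] h3]; lra.
  rewrite (_ : _ `&` _ = set0) ?measure0 ?mule0 //.
  apply/seteqP; split=> x //=; rewrite !in_itv /= ?andbT.
  by move=> [/andP[h1 h2] h3]; lra.
- by apply: measurableT_comp => //; apply: measurable_funD.
Qed.

(** The map x / (x + 1) carries [mu] on the half-line to twice [mu] on [0,1]: the points sent beyond
    a form the ray from a / (1 - a), of mass 1 - 2 F(a) = 2 (F(1) - F(a)) by [mink_half]. *)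
Lemma mink_moment_half L :
  (\int[mu]_(x in `[0%R, +oo[) ((x / (x + 1)) ^+ L)%:E =
   2%:E * \int[mu]_(x in `[0%R, 1%R]) (x ^+ L)%:E)%E.
Proof.
have c0 : 0 <= 2 :> R by [].
(* Absolute values make the map continuous and the integrand nonnegative on the whole line, as
   [mink_measure_pushforward] demands. *)
transitivity (\int[mu]_(x in `[0%R, +oo[) (`|x / (`|x| + 1)| ^+ L)%:E)%E.
  apply: eq_integral => x; rewrite inE /= in_itv /= andbT => x0.
  by rewrite (ger0_norm x0) ger0_norm // divr_ge0 // addr_ge0.
have -> : (\int[mu]_(x in `[0%R, 1%R]) (x ^+ L)%:E =
    \int[mu]_(x in `[0%R, 1%R]) (`|x| ^+ L)%:E)%E.
  apply: eq_integral => x; rewrite inE /= in_itv /= => /andP[x0 _].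
  by rewrite ger0_norm.
apply: (@mink_measure_pushforward (fun x => x / (`|x| + 1)) `[0, +oo[ `[0, 1] (NngNum c0)
  _ _ _ _ (fun x => `|x| ^+ L)) => //=.
- apply: continuous_measurable_fun => x.
  apply: cvgM; first exact: cvg_id.
  apply: cvgV; first by rewrite gt_eqF // ltr_wpDl.
  by apply: cvgD; [apply: cvg_norm; exact: cvg_id|exact: cvg_cst].
- move=> a; have [a0|a0] := ltP a 0.
    rewrite (_ : _ `&` _ = `[0, +oo[%classic); last first.
      apply/seteqP; split=> x /=; rewrite !in_itv /= ?andbT; first by case.
      move=> x0; split=> //; apply: (lt_le_trans a0).
      by rewrite divr_ge0 // addr_ge0.
    rewrite (_ : _ `&` _ = `[0, 1]%classic); last first.
      apply/seteqP; split=> x /=; rewrite !in_itv /= ?andbT; first by case.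
      by move=> /andP[h1 h2]; rewrite h1 h2; split=> //; lra.
    rewrite mink_measure_itv // mink_measure_y -EFinM; congr EFin.
    by rewrite (mink_nat R 1) (mink_nat R 0) expr0; field.
  have [a1|a1] := ltP a 1.
    have b0 : 0 <= a / (1 - a) by rewrite divr_ge0 // subr_ge0 ltW.
    rewrite (_ : _ `&` _ = `](a / (1 - a)), +oo[%classic); last first.
      apply/seteqP; split=> x /=; rewrite !in_itv /= ?andbT.
        move=> [x0]; rewrite ger0_norm // ltr_pdivlMr ?ltr_wpDl // => ax.
        by rewrite ltr_pdivrMr ?subr_gt0 //; lra.
      move=> ax; have x0 : 0 <= x by rewrite ltW // (le_lt_trans b0).
      split=> //; rewrite ger0_norm // ltr_pdivlMr ?ltr_wpDl //.
      by move: ax; rewrite ltr_pdivrMr ?subr_gt0 //; lra.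
    rewrite (_ : _ `&` _ = `]a, 1]%classic); last first.
      apply/seteqP; split=> x /=; rewrite !in_itv /= ?andbT.
        by move=> [/andP[h1 h2] h3]; rewrite h2 h3.
      by move=> /andP[h1 h2]; rewrite h2 h1 andbT; split=> //; lra.
    rewrite mink_measure_itv // mink_measure_y mink_half // -EFinM; congr EFin.
    by rewrite (mink_nat R 1); field.
  rewrite (_ : _ `&` _ = set0); last first.
    apply/seteqP; split=> x //=; rewrite !in_itv /= ?andbT => -[x0].
    by rewrite ger0_norm // ltr_pdivlMr ?ltr_wpDl //; nra.
  rewrite (_ : _ `&` _ = set0) ?measure0 ?mule0 //.
  apply/seteqP; split=> x //=; rewrite !in_itv /= ?andbT.
  by move=> [/andP[h1 h2] h3]; lra.
- by apply: measurable_funX; exact: normr_measurable.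
Qed.

(** * The integral of 2^t against dF *)

Lemma powR2_expR (x : R) : 2 `^ x = expR (ln 2 * x).
Proof. by rewrite /powR pnatr_eq0 /= mulrC. Qed.

Lemma is_derive_powR2 (x : R) : is_derive x 1 (fun t : R => 2 `^ t) (ln 2 * 2 `^ x).
Proof.
rewrite (_ : (fun t : R => 2 `^ t) = (fun t => expR (ln 2 * t))); last first.
  by apply/funext => t; rewrite powR2_expR.
rewrite powR2_expR; apply: is_derive_eq.
by rewrite /GRing.scale /=; ring.
Qed.

Lemma continuous_powR2 : continuous (fun t : R => 2 `^ t).
Proof.
move=> x; apply: differentiable_continuous; apply/derivable1_diffP.
by have [] := is_derive_powR2 x.
Qed.

Lemma integral_powR2 (t : R) : 0 <= t ->
  (\int[lebesgue_measure]_(s in `[0%R, t[) (ln 2 * 2 `^ s)%:E = (2 `^ t - 1)%:E)%E.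
Proof.
rewrite le_eqVlt => /predU1P[<-|t0].
  by rewrite set_itvco0 integral_set0 powRr0 subrr.
rewrite integral_itv_bndo_bndc; last first.
  apply/measurable_EFinP; apply: measurable_funTS; apply: continuous_measurable_fun => x.
  by apply: cvgM; [exact: cvg_cst|exact: continuous_powR2].
rewrite (@continuous_FTC2 _ _ (fun t : R => 2 `^ t)) ?powRr0 //.
- apply: continuous_subspaceT => x.
  by apply: cvgM; [exact: cvg_cst|exact: continuous_powR2].
- split.
  + by move=> x _; have [] := is_derive_powR2 x.
  + by apply: cvg_at_right_filter; exact: continuous_powR2.
  + by apply: cvg_at_left_filter; exact: continuous_powR2.
- by move=> x _; rewrite derive1E; have [_ ->] := is_derive_powR2 x.
Qed.

(** Both sides integrate ln 2 * 2^s over the triangle 0 <= s < t < 1, with dF in t and Lebesgue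
    measure in s. Integrating in s first gives 2^t - 1; integrating in t first gives the mass F(1) -
    F(s), where F(1) = 1/2. *)
Lemma integral_mink_powR2_tonelli :
  (\int[mu]_(t in `[0%R, 1%R[) (2 `^ t - 1)%:E =
   \int[lebesgue_measure]_(s in `[0%R, 1%R[) (ln 2 * 2 `^ s * (2^-1 - F s))%:E)%E.
Proof.
have l0 : 0 <= ln 2 :> R by rewrite ln_ge0 // ler1n.
pose A := [set z : measurableTypeR R * R | 0 <= z.2 /\ z.2 < z.1 /\ z.1 < 1].
have mA : measurable A.
  rewrite (_ : A = [set z | 0 <= z.2] `&` ([set z | z.2 < z.1] `&` [set z | z.1 < 1])) //.
  apply: measurableI; last apply: measurableI.
  - rewrite (_ : [set z | _] = snd @^-1` `[0, +oo[%classic); last first.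
      by apply/seteqP; split=> z /=; rewrite in_itv /= andbT.
    by rewrite -[X in measurable X]setTI; exact: measurable_snd.
  - rewrite (_ : [set z | _] = (fun z : measurableTypeR R * R => (z.1 : R) - z.2) @^-1` `]0, +oo[%classic); last first.
      by apply/seteqP; split=> z /=; rewrite in_itv /= andbT subr_gt0.
    rewrite -[X in measurable X]setTI.
    by apply: (measurable_funB measurable_fst measurable_snd).
  - rewrite (_ : [set z | _] = fst @^-1` `]-oo, 1[%classic); last first.
      by apply/seteqP; split=> z /=; rewrite in_itv /=.
    by rewrite -[X in measurable X]setTI; exact: measurable_fst.
pose f (z : measurableTypeR R * R) : \bar R := (ln 2 * 2 `^ z.2 * \1_A z)%:E.
have f0 z : (0 <= f z)%E.
  by rewrite lee_fin !mulr_ge0 ?powR_ge0.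
have mf : measurable_fun setT f.
  apply/measurable_EFinP; apply: measurable_funM => //.
  apply: measurable_funM => //.
  apply: (measurableT_comp (f := fun t : R => 2 `^ t)) => //.
  by apply: continuous_measurable_fun; exact: continuous_powR2.
have := @fubini_tonelli _ _ _ _ _ mu lebesgue_measure f mf f0.
have -> : (\int[mu]_x \int[lebesgue_measure]_y f (x, y) =
    \int[mu]_(t in `[0%R, 1%R[) (2 `^ t - 1)%:E)%E.
  rewrite [RHS]integral_mkcond; apply: eq_integral => t _.
  rewrite patchE; case: ifPn => [|tN].
    rewrite inE /= in_itv /= => /andP[t0 t1].
    rewrite -integral_powR2 // [RHS]integral_mkcond; apply: eq_integral => s _.
    rewrite patchE /f indicE /=; case: ifPn => sA.
      by rewrite mem_set ?mulr1 //; move: sA; rewrite inE /= in_itv /= => /andP[].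
    rewrite memNset ?mulr0 // => -[/= s0 [st _]]; move/negP: sA; apply.
    by rewrite inE /= in_itv /= s0 st.
  rewrite integral0_eq // => s _; rewrite /f indicE memNset ?mulr0 //.
  move=> -[/= s0 [st t1]]; move/negP: tN; apply.
  by rewrite inE /= in_itv /= t1 andbT; lra.
move=> ->; rewrite [RHS]integral_mkcond; apply: eq_integral => s _.
rewrite patchE; case: ifPn => [|sN].
  rewrite inE /= in_itv /= => /andP[s0 s1].
  transitivity (\int[mu]_(t in `]s, 1%R[) (ln 2 * 2 `^ s)%:E)%E.
    rewrite [RHS]integral_mkcond; apply: eq_integral => t _.
    rewrite patchE /f indicE /=; case: ifPn => tA.
      by rewrite mem_set ?mulr1 //; move: tA; rewrite inE /= in_itv /= => /andP[].
    rewrite memNset ?mulr0 // => -[/= _ [st t1]]; move/negP: tA; apply.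
    by rewrite inE /= in_itv /= st t1.
  rewrite integral_cst // [X in (_ * X)%E](_ : _ = (F 1 - F s)%:E).
    rewrite (mink_nat R 1) -EFinM; congr EFin.
    by field.
  exact: (@mink_measure_itv false true).
rewrite integral0_eq // => t _; rewrite /f indicE memNset ?mulr0 //.
move=> -[/= s0 [st t1]]; move/negP: sN; apply.
by rewrite inE /= in_itv /= s0; lra.
Qed.

(** Write 2^t = 1 + (2^t - 1). The constant contributes the mass 1/2 of the unit cell. In the other
    part 1/2 - F = (1 - F) - 1/2 yields ln 2 * c_0 minus one half, as ln 2 * 2^s has Lebesgue
    integral 1 over [0,1]. *)
Lemma integral_mink_powR2 :
  (\int[mu]_(t in `[0%R, 1%R[) (2 `^ t)%:E = (ln 2 * Psi_mean R)%:E)%E.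
Proof.
have c2 := continuous_powR2.
have cmF : continuous (fun s : R => 2^-1 - F s).
  by move=> x; apply: cvgB; [exact: cvg_cst|exact: mink_continuous].
have cG : continuous (fun s : R => ln 2 * 2 `^ s).
  by move=> x; apply: cvgM; [exact: cvg_cst|exact: c2].
have cGF : continuous (fun s : R => ln 2 * 2 `^ s * (2^-1 - F s)).
  by move=> x; apply: cvgM; [exact: cG|exact: cmF].
have m2 : measurable_fun setT (fun t : R => 2 `^ t) by exact: continuous_measurable_fun.
transitivity (\int[mu]_(t in `[0%R, 1%R[) ((1%:E) + (2 `^ t - 1)%:E))%E.
  by apply: eq_integral => t _; rewrite -EFinD; congr EFin; ring.
rewrite ge0_integralD //=; last 2 first.
- move=> t; rewrite in_itv /= => /andP[t0 _]; rewrite lee_fin subr_ge0.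
  by rewrite -[X in X <= _](@powRr0 _ 2) ler_powR // ler1n.
- by apply/measurable_EFinP; apply: measurable_funTS; apply: measurable_funB.
rewrite integral_mink_powR2_tonelli integral_cst //.
rewrite [X in (_ * X)%E](_ : _ = (F 1 - F 0)%:E); last exact: (@mink_measure_itv true true).
rewrite (mink_nat R 1) (mink_nat R 0) expr0.
rewrite integral_itv_bndo_bndc; last first.
  by apply/measurable_EFinP; apply: measurable_funTS; exact: continuous_measurable_fun.
have int (h : R -> R) : continuous h -> lebesgue_measure.-integrable `[0, 1] (EFin \o h).
  move=> ch; apply: continuous_compact_integrable; first exact: segment_compact.
  exact: continuous_subspaceT.
have fin (h : R -> R) : continuous h ->
    (\int[lebesgue_measure]_(s in `[0%R, 1%R]) (h s)%:E = (\int[lebesgue_measure]_(s in `[0, 1]) h s)%:E)%E.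
  by move=> ch; rewrite /Rintegral fineK // integrable_fin_num //; exact: int.
rewrite fin // -!EFinM -EFinD; congr EFin.
have cP : continuous (@Psi R).
  move=> x; apply: cvgM; first exact: c2.
  by apply: cvgB; [exact: cvg_cst|exact: mink_continuous].
have i2 : \int[lebesgue_measure]_(s in `[0, 1]) (ln 2 * 2 `^ s) = 1 :> R.
  have := integral_powR2 ler01.
  rewrite integral_itv_bndo_bndc; last first.
    by apply/measurable_EFinP; apply: measurable_funTS; exact: continuous_measurable_fun.
  by rewrite fin // powRr1 // => -[->]; ring.
transitivity (1 / 2 + (ln 2 * Psi_mean R - 2^-1 * \int[lebesgue_measure]_(s in `[0, 1]) (ln 2 * 2 `^ s))).
  congr (_ + _); first by field.
  rewrite /Psi_mean -!RintegralZl //; [|exact: int..].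
  rewrite -RintegralB //; last 2 first.
  - by apply: int => x; apply: cvgM; [exact: cvg_cst|exact: cP].
  - by apply: int => x; apply: cvgM; [exact: cvg_cst|exact: cG].
  by apply: eq_Rintegral => s _; rewrite /Psi; field.
by rewrite i2; field.
Qed.

(** * Reduction of integrals over the half-line to sums over the integer cells *)

Lemma mink_integrable_bounded (D : set R) (h : R -> R) (M : R) : measurable D ->
  measurable_fun setT h -> (forall x, D x -> `|h x| <= M) ->
  mu.-integrable D (EFin \o h).
Proof.
move=> mD mh hM; apply: measurable_bounded_integrable => //.
- apply: (@le_lt_trans _ _ (mu setT)); last by rewrite mink_measure_setT ltry.
  by apply: le_measure; rewrite ?inE.
- exact: measurable_funTS.
- exists M; split; first exact: num_real.
  by move=> x Mx t Dt; exact: le_trans (hM _ Dt) (ltW Mx).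
Qed.

(** The half-line is cut at the integers and each cell is moved to [0,1[ by [mink_measure_shift].
    Boundedness of [h] makes every integral finite, so convergence passes from extended to real
    values. *)
Lemma cvg_mink_integral_cells (h : R -> R) : measurable_fun setT h ->
  (forall x, 0 <= h x <= 1) ->
  (fun N => \int[mu]_(t in `[0, 1[) \sum_(n < N) 2 ^- n * h (t + n%:R)) @ \oo -->
  \int[mu]_(x in `[0, +oo[) h x.
Proof.
move=> mh h01.
have h0 x : 0 <= h x by have /andP[] := h01 x.
have mh' : measurable_fun setT (EFin \o h) by exact/measurable_EFinP.
have mhn n : measurable_fun setT (fun t : R => 2 ^- n * h (t + n%:R)).
  apply: measurable_funM => //; apply: measurableT_comp => //.
  exact: measurable_funD.
have c0 n : 0 <= 2 ^- n :> R by rewrite invr_ge0 exprn_ge0.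
have E : `[0, +oo[%classic = \bigcup_n `[n%:R, n.+1%:R[%classic :> set R.
  apply/seteqP; split=> x /=; rewrite in_itv /= ?andbT.
    move=> x0; exists (Num.truncn x) => //=.
    by rewrite in_itv /= truncn_itv.
  by move=> [n _] /=; rewrite in_itv /= => /andP[h1 _]; rewrite (le_trans _ h1).
have c : (fun N => \sum_(0 <= n < N) \int[mu]_(x in `[n%:R, n.+1%:R[) (h x)%:E)%E @ \oo -->
    (\int[mu]_(x in `[0%R, +oo[) (h x)%:E)%E.
  rewrite E ge0_integral_bigcup //.
  - apply: is_cvg_nneseries => n _ _.
    by apply: integral_ge0 => x _; rewrite lee_fin.
  - exact: measurable_funTS.
  - by move=> x _; rewrite lee_fin.
  - apply/trivIsetP => i j _ _ ij; apply/seteqP; split=> x //=.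
    rewrite !in_itv /= => -[/andP[h1 h2] /andP[h3 h4]].
    have := le_lt_trans h1 h4; have := le_lt_trans h3 h2.
    rewrite !ltr_nat !ltnS => ji ij'.
    by move/negP: ij; apply; rewrite eqn_leq ij' ji.
have S N : (\sum_(0 <= n < N) \int[mu]_(x in `[n%:R, n.+1%:R[) (h x)%:E =
    (\int[mu]_(t in `[0, 1[) \sum_(n < N) 2 ^- n * h (t + n%:R))%:E)%E.
  rewrite /Rintegral fineK; last first.
    apply: integrable_fin_num => //.
    apply: (@mink_integrable_bounded _ _ N%:R) => //.
      exact: measurable_sum.
    move=> x _; rewrite ger0_norm; last first.
      by apply: sumr_ge0 => i _; rewrite mulr_ge0.
    rewrite -[N in X in _ <= X]card_ord -sum1_card natr_sum ler_sum // => i _.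
    have /andP[h1 h2] := h01 (x + i%:R).
    by rewrite -[X in _ <= X]mulr1 ler_pM // Defs.half_le1.
  under [RHS]eq_integral do rewrite -sumEFin.
  rewrite ge0_integral_sum //=; last 2 first.
  - by move=> i; apply/measurable_EFinP; exact: (measurable_funTS (mhn i)).
  - by move=> i x _; rewrite lee_fin mulr_ge0.
  rewrite big_mkord; apply: eq_bigr => i _.
  rewrite mink_measure_shift // -ge0_integralZl //=; last 2 first.
  - apply/measurable_EFinP; apply: measurable_funTS; apply: measurableT_comp => //.
    exact: measurable_funD.
  - by move=> x _; rewrite lee_fin.
have fin : (\int[mu]_(x in `[0%R, +oo[) (h x)%:E)%E \is a fin_num.
  apply: integrable_fin_num => //.
  apply: (@mink_integrable_bounded _ h 1) => // x _.
  by have /andP[h1 h2] := h01 x; rewrite ger0_norm.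
rewrite -(fineK fin) (eq_cvg _ _ S) in c.
exact: fine_cvg c.
Qed.

(** A bound on the cell sums relative to 2^t, uniform in t, is integrated against dF by
    [integral_mink_powR2]. The slack [e] lets the hypothesis speak of long partial sums only. *)
Lemma mink_integral_estimate (h : R -> R) (m B : R) : measurable_fun setT h ->
  (forall x, 0 <= h x <= 1) ->
  (forall e, 0 < e -> \forall N \near \oo, forall t, 0 <= t < 1 ->
     `|\sum_(n < N) 2 ^- n * h (t + n%:R) - m * 2 `^ t| <= (B + e) * 2 `^ t) ->
  `|\int[mu]_(x in `[0, +oo[) h x - m * (ln 2 * Psi_mean R)| <= B * (ln 2 * Psi_mean R).
Proof.
move=> mh h01 H.
have h0 x : 0 <= h x by have /andP[] := h01 x.
have mhn n : measurable_fun setT (fun t : R => 2 ^- n * h (t + n%:R)).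
  apply: measurable_funM => //; apply: measurableT_comp => //.
  exact: measurable_funD.
have m2 : measurable_fun setT (fun t : R => 2 `^ t).
  by apply: continuous_measurable_fun; exact: continuous_powR2.
have b2 (t : R) : `[0, 1[%classic t -> `|2 `^ t| <= 2 :> R.
  rewrite /= in_itv /= => /andP[t0 t1]; rewrite ger0_norm ?powR_ge0 //.
  by rewrite -[X in _ <= X]powRr1 // ler_powR ?ler1n // ltW.
have i2 := mink_integrable_bounded (measurable_itv _) m2 b2.
have i2r (r : R) : mu.-integrable `[0, 1[ (EFin \o (fun t : R => r * 2 `^ t)).
  apply: (@mink_integrable_bounded _ _ (`|r| * 2)) => //.
    exact: measurable_funM.
  by move=> t /b2 t2; rewrite normrM ler_wpM2l.
have E2 : \int[mu]_(t in `[0, 1[) 2 `^ t = ln 2 * Psi_mean R.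
  by rewrite /Rintegral integral_mink_powR2.
apply/ler_addgt0Pr => e e0.
(* Dividing the slack by this positive number makes its integral against 2^t dF at most [e]. *)
have K0 : 0 < 1 + `|ln 2 * Psi_mean R| by rewrite ltr_pwDl.
have e'0 : 0 < e / (1 + `|ln 2 * Psi_mean R|) by rewrite divr_gt0.
have c : (fun N => (\int[mu]_(t in `[0, 1[) \sum_(n < N) 2 ^- n * h (t + n%:R)) -
      m * (ln 2 * Psi_mean R)) @ \oo -->
    (\int[mu]_(x in `[0, +oo[) h x) - m * (ln 2 * Psi_mean R).
  by apply: cvgB; [exact: cvg_mink_integral_cells|exact: cvg_cst].
apply: (cvgr_to_le (cvg_norm c)).
near=> N.
have HN : forall t, 0 <= t < 1 ->
   `|\sum_(n < N) 2 ^- n * h (t + n%:R) - m * 2 `^ t| <=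
    (B + e / (1 + `|ln 2 * Psi_mean R|)) * 2 `^ t.
  by near: N; exact: H.
have bS (x : R) : `|\sum_(n < N) 2 ^- n * h (x + n%:R)| <= N%:R.
  rewrite ger0_norm; last first.
    by apply: sumr_ge0 => i _; rewrite mulr_ge0 // invr_ge0 exprn_ge0.
  rewrite -[N in X in _ <= X]card_ord -sum1_card natr_sum ler_sum // => i _.
  have /andP[h1 h2] := h01 (x + i%:R).
  by rewrite -[X in _ <= X]mulr1 ler_pM // ?Defs.half_le1 // invr_ge0 exprn_ge0.
have mS : measurable_fun setT (fun x : R => \sum_(n < N) 2 ^- n * h (x + n%:R)).
  exact: measurable_sum.
have iS : mu.-integrable `[0, 1[ (EFin \o (fun x : R => \sum_(n < N) 2 ^- n * h (x + n%:R))).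
  by apply: (@mink_integrable_bounded _ _ N%:R).
rewrite /= -E2 -RintegralZl // -RintegralB //.
apply: le_trans (le_normr_Rintegral _ _) _ => //.
  apply: (@mink_integrable_bounded _ _ (N%:R + `|m| * 2)) => //.
    by apply: measurable_funB => //; exact: measurable_funM.
  move=> t /b2 t2; apply: le_trans (ler_normB _ _) _.
  by rewrite lerD // normrM ler_wpM2l.
apply: (@le_trans _ _ (\int[mu]_(t in `[0, 1[) ((B + e / (1 + `|ln 2 * Psi_mean R|)) * 2 `^ t))).
  apply: le_Rintegral => //.
  - apply: (@mink_integrable_bounded _ _ (N%:R + `|m| * 2)) => //.
      by apply: measurableT_comp => //; apply: measurable_funB => //; exact: measurable_funM.
    move=> t /b2 t2; rewrite normr_id; apply: le_trans (ler_normB _ _) _.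
    by rewrite lerD // normrM ler_wpM2l.
rewrite RintegralZl // E2 mulrDl lerD2l mulrAC ler_pdivrMr // ler_wpM2l ?ltW //.
by apply: le_lt_trans (ler_norm _) _; rewrite ltrDr.
Unshelve. all: by end_near. Qed.

End mink_measure.

(** * Comparison of shifted sums with primitives *)

Section monotone_by_derivative.
Variables (R : realType) (f df : R -> R) (a b : R).
Hypothesis ab : a <= b.
Hypothesis fd : forall x, a <= x <= b -> is_derive x 1 f (df x).

Lemma is_derive_within_continuous : {within `[a, b], continuous f}.
Proof.
apply: derivable_within_continuous => x; rewrite in_itv /= => xab.
by have [] := fd xab.
Qed.

Lemma MVT_le : exists2 c, a <= c <= b & f b - f a = df c * (b - a).
Proof.
have fd' x : x \in `]a, b[ -> is_derive x 1 f (df x).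
  by rewrite in_itv /= => /andP[ax xb]; apply: fd; rewrite !ltW.
have [c cab E] := MVT_segment ab fd' is_derive_within_continuous.
by exists c => //; move: cab; rewrite in_itv.
Qed.

Lemma derive_ge0_le : (forall x, a <= x <= b -> 0 <= df x) -> f a <= f b.
Proof.
move=> d0; have [c cab E] := MVT_le.
by rewrite -subr_ge0 E mulr_ge0 ?subr_ge0 // d0.
Qed.

End monotone_by_derivative.

Section shifted_sums.
Variable R : realType.
Implicit Types (f g : R -> R) (N : nat) (t : R).

Definition shift_sum f N t := \sum_(n < N) f (t + n%:R).

Lemma is_derive_shift_sum f g N t : 0 <= t ->
  (forall x : R, 0 <= x -> is_derive x 1 f (g x)) ->
  is_derive t 1 (shift_sum f N) (shift_sum g N t).
Proof.
move=> t0 fd; rewrite /shift_sum; elim: N => [|N IH].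
  rewrite big_ord0 (_ : (fun _ => _) = cst 0); first exact: is_derive_cst.
  by apply/funext => x; rewrite big_ord0.
rewrite big_ord_recr /= (_ : (fun _ => _) =
    (fun t => \sum_(n < N) f (t + n%:R)) + (fun t => f (t + N%:R))); last first.
  by apply/funext => x; rewrite big_ord_recr.
apply: is_deriveD.
have d1 : is_derive t 1 (fun t => t + N%:R) (1 + 0).
  by apply: is_deriveD.
have d2 : is_derive (t + N%:R) 1 f (g (t + N%:R)) by apply: fd; rewrite addr_ge0.
have := @is_derive1_comp _ f (fun t => t + N%:R) t _ _ d2 d1.
by rewrite addr0 mulr1.
Qed.

Lemma shift_sum_telescope f N : shift_sum f N 1 - shift_sum f N 0 = f N%:R - f 0.
Proof.
rewrite /shift_sum; elim: N => [|N IH]; first by rewrite !big_ord0 subrr subrr.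
rewrite !big_ord_recr /= add0r (addrC 1 N%:R) natr1.
by rewrite opprD addrACA IH addrC addrA subrK.
Qed.

(* A single intermediate point serves for all the terms of the sum. *)
Lemma shift_sum_MVT f g N : (forall x : R, 0 <= x -> is_derive x 1 f (g x)) ->
  exists2 c : R, 0 <= c <= 1 & f N%:R - f 0 = shift_sum g N c.
Proof.
move=> fd; have d (x : R) : 0 <= x <= 1 -> is_derive x 1 (shift_sum f N) (shift_sum g N x).
  by move=> /andP[x0 _]; exact: is_derive_shift_sum.
have [c c01] := MVT_le ler01 d.
by rewrite subr0 mulr1 shift_sum_telescope => E; exists c.
Qed.

(** [f1] and [f2] are the first two derivatives of [f]; [D] is a primitive of a majorant of |f''|,
    so its increments bound the variation of f'. *)
Variables (f f1 f2 D d : R -> R).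
Hypothesis fd : forall x : R, 0 <= x -> is_derive x 1 f (f1 x).
Hypothesis f1d : forall x : R, 0 <= x -> is_derive x 1 f1 (f2 x).
Hypothesis Dd : forall x : R, 0 <= x -> is_derive x 1 D (d x).
Hypothesis f2d : forall x : R, 0 <= x -> `|f2 x| <= d x.

Let f1_le x y : 0 <= x -> x <= y -> `|f1 y - f1 x| <= D y - D x.
Proof.
move=> x0 xy.
have dp (z : R) : x <= z <= y -> is_derive z 1 (D - f1) (d z - f2 z).
  move=> /andP[xz _]; have z0 := le_trans x0 xz.
  by have d1 := fd z0; have d2 := f1d z0; have d3 := Dd z0; apply: is_deriveB.
have dm (z : R) : x <= z <= y -> is_derive z 1 (D + f1) (d z + f2 z).
  move=> /andP[xz _]; have z0 := le_trans x0 xz.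
  by have d1 := fd z0; have d2 := f1d z0; have d3 := Dd z0; apply: is_deriveD.
have := derive_ge0_le xy dp; have := derive_ge0_le xy dm.
have f2z (z : R) : x <= z <= y -> - d z <= f2 z <= d z.
  by move=> /andP[xz _]; rewrite -ler_norml; apply: f2d; exact: le_trans xz.
have h1 (z : R) : x <= z <= y -> 0 <= d z + f2 z by move=> /f2z; lra.
have h2 (z : R) : x <= z <= y -> 0 <= d z - f2 z by move=> /f2z; lra.
move=> /(_ h1) + /(_ h2) => /=.
change ((D + f1) x) with (D x + f1 x); change ((D + f1) y) with (D y + f1 y).
change ((D - f1) x) with (D x - f1 x); change ((D - f1) y) with (D y - f1 y).
by rewrite ler_norml; lra.
Qed.

Let D_le x y : 0 <= x -> x <= y -> D x <= D y.
Proof.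
by move=> x0 xy; rewrite -subr_ge0; apply: le_trans (f1_le x0 xy).
Qed.

(** Let S be the shifted sum. By the mean value theorem S(t) - S(u) = (t - u) S'(c), while S'(x) =
    f(N) - f(0) for some x in [0,1]. In S'(c) - S'(x) each term is a difference of f' inside one
    cell, and the bounds by increments of [D] over the cells telescope. *)
Lemma shift_sum_oscillation N t u : 0 <= t <= 1 -> 0 <= u <= 1 ->
  `|shift_sum f N t - shift_sum f N u| <= `|f N%:R - f 0| + (D N%:R - D 0).
Proof.
wlog tu : t u / u <= t => [W t01 u01|].
  by case: (leP u t) => ut; [|rewrite distrC]; apply: W => //; exact: ltW.
move=> /andP[t0 t1] /andP[u0 u1].
have dS (x : R) : u <= x <= t -> is_derive x 1 (shift_sum f N) (shift_sum f1 N x).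
  by move=> /andP[ux _]; apply: is_derive_shift_sum => //; exact: le_trans ux.
have [c /andP[uc ct] ->] := MVT_le tu dS.
have [x /andP[x0 x1] ->] := shift_sum_MVT N fd.
have c0 := le_trans u0 uc; have c1 := le_trans ct t1.
rewrite normrM -[X in _ <= X]mulr1 ler_pM //; last by rewrite ger0_norm; lra.
rewrite -lerBlDl; apply: le_trans (lerB_dist _ _) _.
rewrite /shift_sum -sumrB -shift_sum_telescope /shift_sum -sumrB.
apply: le_trans (ler_norm_sum _ _ _) _; apply: ler_sum => n _.
have n0 : 0 <= n%:R :> R by [].
have Dn (y : R) : 0 <= y <= 1 -> D (0 + n%:R) <= D (y + n%:R) <= D (1 + n%:R).
  by move=> /andP[y0 y1]; rewrite !D_le ?addr_ge0 ?lerD2r.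
have /andP[hx hx'] := Dn x (introT andP (conj x0 x1)).
have /andP[hc hc'] := Dn c (introT andP (conj c0 c1)).
case: (leP x c) => xc.
  apply: (@le_trans _ _ (D (c + n%:R) - D (x + n%:R))); last lra.
  by apply: f1_le; rewrite ?addr_ge0 ?lerD2r.
rewrite distrC; apply: (@le_trans _ _ (D (x + n%:R) - D (c + n%:R))); last lra.
by apply: f1_le; rewrite ?addr_ge0 ?lerD2r // ltW.
Qed.

(** At one point c the shifted sum of [a] equals A(N) - A(0) exactly; the oscillation bound carries
    the comparison from c to t. *)
Lemma shift_sum_le (A a : R -> R) N t : (forall x : R, 0 <= x -> is_derive x 1 A (a x)) ->
  (forall x : R, 0 <= x -> f x <= a x) -> 0 <= t <= 1 ->
  shift_sum f N t <= A N%:R - A 0 + (`|f N%:R - f 0| + (D N%:R - D 0)).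
Proof.
move=> Ad fa t01; have [c c01 ->] := shift_sum_MVT N Ad.
have := shift_sum_oscillation N t01 c01; rewrite ler_norml => /andP[_ h].
have : shift_sum f N c <= shift_sum a N c.
  by apply: ler_sum => n _; apply: fa; case/andP: c01 => c0 _; rewrite addr_ge0.
lra.
Qed.

Lemma shift_sum_ge (A a : R -> R) N t : (forall x : R, 0 <= x -> is_derive x 1 A (a x)) ->
  (forall x : R, 0 <= x -> a x <= f x) -> 0 <= t <= 1 ->
  A N%:R - A 0 - (`|f N%:R - f 0| + (D N%:R - D 0)) <= shift_sum f N t.
Proof.
move=> Ad fa t01; have [c c01 ->] := shift_sum_MVT N Ad.
have := shift_sum_oscillation N t01 c01; rewrite ler_norml => /andP[h _].
have : shift_sum a N c <= shift_sum f N c.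
  by apply: ler_sum => n _; apply: fa; case/andP: c01 => c0 _; rewrite addr_ge0.
lra.
Qed.

End shifted_sums.

(** * Gaussian profiles *)

Section gaussian_cdf.
Variable R : realType.
Implicit Types x : R.

(** Not normalised: the total mass is the square root of pi. *)
Definition gauss_cdf x : R := \int[lebesgue_measure]_(t in `]-oo, x]) gauss_fun t.

Let gauss_integrable (D : set R) : measurable D ->
  lebesgue_measure.-integrable D (EFin \o @gauss_fun R).
Proof. by move=> mD; apply: integrableS (integrableT_gauss (R := R)). Qed.

Lemma is_derive_gauss_cdf x : is_derive x 1 gauss_cdf (expR (- x ^+ 2)).
Proof.
have x1 : x < x + 1 by rewrite ltrDl.
have [||] := @continuous_FTC1 R (@gauss_fun R) -oo%O x (x + 1) x1
  (gauss_integrable (measurable_itv _)).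
- by rewrite ltNyr.
- exact: continuous_gauss_fun.
by move=> h; rewrite derive1E => E; exact: DeriveDef.
Qed.

Let gauss_total x : gauss_cdf x +
  \int[lebesgue_measure]_(t in `]x, +oo[) gauss_fun t = Num.sqrt pi.
Proof.
have := @integralT_gauss R; rewrite /gauss_cdf => E.
have : \int[lebesgue_measure]_t (@gauss_fun R t) = Num.sqrt pi.
  by rewrite /Rintegral E.
move=> <-; rewrite -(setUv `]-oo, x]%classic) setCitvl Rintegral_setU //.
- by rewrite -setCitvl setUv; exact: integrableT_gauss.
- by rewrite -setCitvl disj_set2E setICr.
Qed.

Lemma gauss_cdf_ge0 x : 0 <= gauss_cdf x.
Proof. by apply: Rintegral_ge0 => t _; exact: gauss_fun_ge0. Qed.

Lemma gauss_cdf_le x : gauss_cdf x <= Num.sqrt pi.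
Proof.
rewrite -(gauss_total x) lerDl.
by apply: Rintegral_ge0 => t _; exact: gauss_fun_ge0.
Qed.

(** The sum of the values at y and -y has derivative zero, and at y = 0 it is twice the half-line
    Gaussian integral. *)
Lemma gauss_cdfN x : 0 <= x -> gauss_cdf (- x) = Num.sqrt pi - gauss_cdf x.
Proof.
have E0 : gauss_cdf 0 = Num.sqrt pi / 2.
  have := gauss_total 0; rewrite [X in _ + X](_ : _ = Num.sqrt pi / 2).
    lra.
  rewrite Rintegral_itv_obnd_cbnd; last exact: gauss_integrable.
  by rewrite /Rintegral integral0y_gauss.
move=> x0; pose g (y : R) := gauss_cdf (- y) + gauss_cdf y.
have dg (y : R) : 0 <= y <= x -> is_derive y 1 g ((fun=> 0) y).
  move=> _; have d1 := is_derive_gauss_cdf (- y).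
  have d2 : is_derive y 1 (fun y : R => - y) (- 1) by apply: is_deriveN.
  have d3 := @is_derive1_comp _ gauss_cdf (fun y : R => - y) y _ _ d1 d2.
  have d4 := is_deriveD d3 (is_derive_gauss_cdf y).
  apply: (is_derive_eq d4).
  by rewrite sqrrN mulrN mulr1 addNr.
have [c _] := MVT_le x0 dg.
by rewrite mul0r /g oppr0 E0 => h; lra.
Qed.

(** For t >= x the density is at most (t / x) exp(-t^2), which has an explicit primitive; the tail
    is thus at most exp(-x^2) / (2 x). *)
Lemma gauss_cdf_tail x : 0 < x -> Num.sqrt pi - x^-1 <= gauss_cdf x.
Proof.
move=> x0; rewrite lerBlDr -(gauss_total x) lerD2l.
have x20 : 0 < 2 * x by rewrite mulr_gt0.
pose F (t : R) := - expR (- t ^+ 2) / (2 * x).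
pose f (t : R) := t / x * expR (- t ^+ 2).
have dF (t : R) : is_derive t 1 F (f t).
  rewrite /F /f.
  have d1 : is_derive t 1 (fun t : R => - t ^+ 2) (- (2 * t)).
    by apply: is_derive_eq; rewrite /GRing.scale /=; ring.
  have d2 := @is_derive1_comp _ (@expR R) (fun t : R => - t ^+ 2) t _ _ (is_derive_expR _) d1.
  have d3 := is_deriveN d2.
  have d4 := @is_deriveM _ _ _ (fun => (2 * x)^-1) t 1 _ _ d3 (is_derive_cst _ _ _).
  apply: (is_derive_eq d4).
  rewrite /GRing.scale /= mulr0 add0r; field; rewrite gt_eqF //.
have cf : continuous f.
  move=> t; apply: cvgM; last exact: continuous_gauss_fun.
  by apply: cvgM; [exact: cvg_id|exact: cvg_cst].
have f0 (t : R) : x <= t -> 0 <= f t.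
  by move=> xt; rewrite mulr_ge0 ?expR_ge0 // divr_ge0 ?(le_trans _ xt) // ltW.
have cF : F t @[t --> +oo] --> (0 : R).
  rewrite -(mul0r (2 * x)^-1) -oppr0; apply: cvgM; last exact: cvg_cst.
  by apply: cvgN; exact: cvg_gauss_fun.
have I : (\int[lebesgue_measure]_(t in `[x, +oo[) (f t)%:E = (0 - F x)%:E)%E.
  rewrite (@ge0_continuous_FTC2y _ f F x 0) //.
  - exact: continuous_subspaceT.
  - apply: cvg_at_right_filter; apply: differentiable_continuous.
    by apply/derivable1_diffP; have [] := dF x.
  - by move=> t _; rewrite derive1E; have [_ ->] := dF t.
apply: (@le_trans _ _ (0 - F x)).
  rewrite -lee_fin -I.
  rewrite /Rintegral fineK; last first.
    by apply: integrable_fin_num => //; exact: gauss_integrable.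
  apply: (@le_trans _ _ (\int[lebesgue_measure]_(t in `[x, +oo[) (gauss_fun t)%:E)%E).
    apply: ge0_subset_integral => //.
    - by have /integrableP[] := gauss_integrable (measurable_itv `[x, +oo[).
    - by move=> t _; rewrite lee_fin gauss_fun_ge0.
    - by apply: subset_itvr; rewrite bnd_simp.
  apply: ge0_le_integral => //.
  - by move=> t _; rewrite lee_fin gauss_fun_ge0.
  - by have /integrableP[] := gauss_integrable (measurable_itv `[x, +oo[).
  - by apply/measurable_EFinP; apply: measurable_funTS; exact: continuous_measurable_fun.
  - move=> t /=; rewrite in_itv /= andbT => xt.
    rewrite lee_fin /f /gauss_fun ler_peMl ?expR_ge0 //.
    by rewrite ler_pdivlMr // mul1r.
rewrite sub0r /F mulNr opprK invfM mulrA ler_piMl ?invr_ge0 ?ltW //.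
have : expR (- x ^+ 2) <= 1 by rewrite -expR0 ler_expR oppr_le0 sqr_ge0.
have := expR_ge0 (- x ^+ 2); lra.
Qed.

Lemma gauss_cdfN_le x : 0 < x -> gauss_cdf (- x) <= x^-1.
Proof.
move=> x0; rewrite (gauss_cdfN (ltW x0)) lerBlDr -lerBlDl.
exact: gauss_cdf_tail.
Qed.

End gaussian_cdf.

(** * Rules for computing derivatives *)

Section scalar_derivatives.
Variable R : realType.
Implicit Types (f g : R -> R) (x a b c : R).

(** The rules are stated for pointwise expressions [fun y => ...] and ring products, the shapes that
    the tactic [der] matches. *)
Lemma der_eq f x a b : is_derive x 1 f a -> a = b -> is_derive x 1 f b.
Proof. by move=> fd <-. Qed.

Lemma der_cst x c : is_derive x 1 (fun=> c) (0 : R).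
Proof. exact: is_derive_cst. Qed.

Lemma der_id x : is_derive x 1 (fun y : R => y) (1 : R).
Proof. exact: is_derive_id. Qed.

Lemma der_add f g x a b : is_derive x 1 f a -> is_derive x 1 g b ->
  is_derive x 1 (fun y => f y + g y) (a + b).
Proof. exact: is_deriveD. Qed.

Lemma der_opp f x a : is_derive x 1 f a -> is_derive x 1 (fun y => - f y) (- a).
Proof. exact: is_deriveN. Qed.

Lemma der_mul f g x a b : is_derive x 1 f a -> is_derive x 1 g b ->
  is_derive x 1 (fun y => f y * g y) (a * g x + f x * b).
Proof.
move=> fd gd; apply: (is_derive_eq (is_deriveM fd gd)).
by rewrite /GRing.scale /= addrC mulrC.
Qed.

Lemma der_exp f n x a : is_derive x 1 f a ->
  is_derive x 1 (fun y => f y ^+ n.+1) (n.+1%:R * f x ^+ n * a).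
Proof.
move=> fd; elim: n => [|n IH]; first by rewrite expr0 !mul1r.
rewrite (_ : (fun y => _) = (fun y => f y * f y ^+ n.+1)); last first.
  by apply/funext => y; rewrite exprS.
apply: (is_derive_eq (der_mul fd IH)).
by rewrite -(natr1 n.+1) (exprS (f x) n); ring.
Qed.

Lemma der_inv f x a : f x != 0 -> is_derive x 1 f a ->
  is_derive x 1 (fun y => (f y)^-1) (- a / f x ^+ 2).
Proof.
move=> f0 fd; apply: (is_derive_eq (is_deriveV f0 fd)).
by rewrite /GRing.scale /= mulrC mulNr mulrN.
Qed.

Lemma der_comp f g x a b : is_derive (g x) 1 f a -> is_derive x 1 g b ->
  is_derive x 1 (fun y => f (g y)) (a * b).
Proof. exact: is_derive1_comp. Qed.

Lemma der_expR f x a : is_derive x 1 f a ->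
  is_derive x 1 (fun y => expR (f y)) (expR (f x) * a).
Proof. move=> fd; exact (@der_comp expR f x _ _ (is_derive_expR (f x)) fd). Qed.

End scalar_derivatives.

(* is_derive is a type class; "notypeclasses refine" keeps the goals produced
   here from being handed to instance search. *)
Ltac der := lazymatch goal with
  | |- is_derive _ _ (fun _ => ?c) _ => notypeclasses refine (der_cst _ _)
  | |- is_derive _ _ (fun y => y) _ => notypeclasses refine (der_id _)
  | H : is_derive _ _ ?e _ |- is_derive _ _ ?e _ => exact H
  | H : is_derive _ _ ?e _ |- is_derive _ _ (fun y => ?e y) _ => exact H
  | |- is_derive _ _ (fun y => GRing.add (@?f y) (@?g y)) _ =>
      notypeclasses refine (@der_add _ f g _ _ _ _ _); der
  | |- is_derive _ _ (fun y => GRing.opp (@?f y)) _ =>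
      notypeclasses refine (@der_opp _ f _ _ _); der
  | |- is_derive _ _ (fun y => GRing.mul (@?f y) (@?g y)) _ =>
      notypeclasses refine (@der_mul _ f g _ _ _ _ _); der
  | |- is_derive _ _ (fun y => GRing.exp (@?f y) (S ?n)) _ =>
      notypeclasses refine (@der_exp _ f n _ _ _); der
  | |- is_derive _ _ (fun y => expR (@?f y)) _ =>
      notypeclasses refine (@der_expR _ f _ _ _); der
  | |- is_derive _ _ (fun y => GRing.inv (@?f y)) _ =>
      notypeclasses refine (@der_inv _ f _ _ _ _); [try by []|der]
  | |- _ => idtac
  end.
Ltac der_by := notypeclasses refine (der_eq _ _); [der|rewrite /=].

Section gaussian_profile.
Variables (R : realType) (sg : R).
Hypothesis sg0 : 0 < sg.
Implicit Types w : R.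

(* profile_upper and profile_lower have derivatives just above and just below
   2 w * profile w, hence enclose its primitive; profile_tail has derivative
   above w^-5 * profile w, the order of all error terms. *)
Definition profile_arg w := sg * (w - w^-1).
Definition profile w := expR (- profile_arg w ^+ 2).
Definition profile_cdf w := gauss_cdf (profile_arg w) / sg.
Definition profile_upper w :=
  (1 + (2 * sg ^+ 2)^-1) * profile_cdf w - w / (2 * sg ^+ 2) * profile w.
Definition profile_lower w :=
  profile_cdf w - w / (w + 1) / sg ^+ 2 * profile w.
Definition profile_tail w :=
  3 / 2 * profile_cdf w + w ^- 2 / sg ^+ 2 * profile w.

Let sgN0 : sg != 0. Proof. by rewrite gt_eqF. Qed.

Lemma der_profile_arg w : 0 < w ->
  is_derive w 1 profile_arg (sg * (1 + w ^- 2)).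
Proof.
move=> w0; have wN0 : w != 0 by rewrite gt_eqF.
rewrite /profile_arg; der_by.
by field.
Qed.

Lemma der_profile w : 0 < w ->
  is_derive w 1 profile (- (2 * sg ^+ 2 * (w - w^-1) * (1 + w ^- 2)) * profile w).
Proof.
move=> w0; have wN0 : w != 0 by rewrite gt_eqF.
have ds := der_profile_arg w0.
rewrite /profile; der_by.
by rewrite -/(profile w) /profile_arg; field.
Qed.

Lemma der_profile_cdf w : 0 < w ->
  is_derive w 1 profile_cdf ((1 + w ^- 2) * profile w).
Proof.
move=> w0; have wN0 : w != 0 by rewrite gt_eqF.
have ds := der_profile_arg w0.
have dg : is_derive w 1 (fun w => gauss_cdf (profile_arg w)) (profile w * (sg * (1 + w ^- 2))).
  by exact (@der_comp _ (@gauss_cdf R) profile_arg w _ _ (is_derive_gauss_cdf _) ds).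
rewrite /profile_cdf; der_by.
by field; rewrite ?wN0 ?sgN0 ?w1.
Qed.

Lemma der_profile_upper w : 0 < w -> is_derive w 1 profile_upper
  (profile w * (w ^+ 2 + 1 + w ^- 2 / (2 * sg ^+ 2))).
Proof.
move=> w0; have wN0 : w != 0 by rewrite gt_eqF.
have dP := der_profile_cdf w0; have de := der_profile w0.
rewrite /profile_upper; der_by.
by field; rewrite ?wN0 ?sgN0 ?w1.
Qed.

Lemma der_profile_lower w : 0 < w -> is_derive w 1 profile_lower
  (profile w * (2 * w - (1 - w^-1) ^+ 2 - (sg ^+ 2 * (w + 1) ^+ 2)^-1)).
Proof.
move=> w0; have wN0 : w != 0 by rewrite gt_eqF.
have w1 : w + 1 != 0 by rewrite gt_eqF // addr_gt0.
have dP := der_profile_cdf w0; have de := der_profile w0.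
rewrite /profile_lower; der_by.
by field; rewrite ?wN0 ?sgN0 ?w1.
Qed.

Lemma der_profile_tail w : 0 < w -> is_derive w 1 profile_tail
  (profile w * (3 / 2 * (1 + w ^- 2) - 2 * w ^- 3 / sg ^+ 2 + 2 * (w ^- 5 - w^-1))).
Proof.
move=> w0; have wN0 : w != 0 by rewrite gt_eqF.
have w2N0 : w ^+ 2 != 0 by rewrite expf_neq0.
have dP := der_profile_cdf w0; have de := der_profile w0.
rewrite /profile_tail; der_by.
by field; rewrite ?wN0 ?sgN0 ?w1.
Qed.

Lemma profile_ge0 w : 0 <= profile w. Proof. exact: expR_ge0. Qed.

Lemma profile_upper_ge w : 0 < w ->
  2 * w * profile w <= profile w * (w ^+ 2 + 1 + w ^- 2 / (2 * sg ^+ 2)).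
Proof.
move=> w0; rewrite mulrC ler_wpM2l ?profile_ge0 //.
have : 0 <= w ^- 2 / (2 * sg ^+ 2).
  by rewrite divr_ge0 ?invr_ge0 ?exprn_ge0 ?mulr_ge0 ?exprn_ge0 // ltW.
by have := sqr_ge0 (w - 1); nra.
Qed.

Lemma profile_lower_le w : 0 < w ->
  profile w * (2 * w - (1 - w^-1) ^+ 2 - (sg ^+ 2 * (w + 1) ^+ 2)^-1) <=
  2 * w * profile w.
Proof.
move=> w0; rewrite (mulrC _ (profile w)) ler_wpM2l ?profile_ge0 //.
have : 0 <= (sg ^+ 2 * (w + 1) ^+ 2)^-1.
  by rewrite invr_ge0 mulr_ge0 ?sqr_ge0.
by have := sqr_ge0 (1 - w^-1); lra.
Qed.

Lemma profile_tail_ge w : 1 <= sg -> 0 < w ->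
  w ^- 5 * profile w <=
  profile w * (3 / 2 * (1 + w ^- 2) - 2 * w ^- 3 / sg ^+ 2 + 2 * (w ^- 5 - w^-1)).
Proof.
move=> sg1 w0; rewrite mulrC ler_wpM2l ?profile_ge0 //.
rewrite -!(exprVn w); set v := w^-1; have v0 : 0 < v by rewrite invr_gt0.
have h : 2 * v ^+ 3 / sg ^+ 2 <= 2 * v ^+ 3.
  rewrite ler_pdivrMr ?exprn_gt0 // ler_peMr ?exprn_ege1 //.
  by rewrite mulr_ge0 ?exprn_ge0 // ltW.
have h1 : 0 <= v * (1 - v ^+ 2) ^+ 2 by rewrite mulr_ge0 ?sqr_ge0 // ltW.
have h2 := sqr_ge0 (1 - v).
(* Three nonnegative terms, the last because sg >= 1. The coefficient 3/2 in [profile_tail] is what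
   makes the linear terms match: -3 v + v = -2 v. *)
rewrite -subr_ge0 (_ : _ - _ = 3 / 2 * (1 - v) ^+ 2 + v * (1 - v ^+ 2) ^+ 2 +
  (2 * v ^+ 3 - 2 * v ^+ 3 / sg ^+ 2)); last by field.
lra.
Qed.

Let cdf_ge0 w : 0 <= profile_cdf w.
Proof. by rewrite divr_ge0 ?gauss_cdf_ge0 // ltW. Qed.

Let cdf_le w : profile_cdf w <= Num.sqrt pi / sg.
Proof. by rewrite ler_pM2r ?invr_gt0 // gauss_cdf_le. Qed.

Lemma profile_le1 w : profile w <= 1.
Proof. by rewrite -expR0 ler_expR oppr_le0 sqr_ge0. Qed.

Lemma profile_upper_total u w : 0 < u -> 0 < w ->
  profile_upper w - profile_upper u <=
  (1 + (2 * sg ^+ 2)^-1) * (Num.sqrt pi / sg) + u / (2 * sg ^+ 2).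
Proof.
move=> u0 w0; rewrite /profile_upper.
have s20 : 0 < 2 * sg ^+ 2 by rewrite mulr_gt0 // exprn_gt0.
have K0 : 0 <= 1 + (2 * sg ^+ 2)^-1 by rewrite addr_ge0 // invr_ge0 ltW.
have h1 : (1 + (2 * sg ^+ 2)^-1) * profile_cdf w <=
    (1 + (2 * sg ^+ 2)^-1) * (Num.sqrt pi / sg) by rewrite ler_wpM2l.
have h2 : 0 <= (1 + (2 * sg ^+ 2)^-1) * profile_cdf u by rewrite mulr_ge0.
have h3 : 0 <= w / (2 * sg ^+ 2) * profile w.
  by rewrite mulr_ge0 ?profile_ge0 // divr_ge0 // ltW.
have h4 : u / (2 * sg ^+ 2) * profile u <= u / (2 * sg ^+ 2).
  by rewrite ler_piMr ?profile_le1 // divr_ge0 // ltW.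
lra.
Qed.

(** Only w^-2 times the profile needs care near w = 0. Since sg >= 1, the profile is at most exp(2 -
    w^-2), and w^-2 <= exp(w^-2), whence the constant e^2. *)
Lemma profile_tail_total u w : 1 <= sg -> 0 < u -> 0 < w ->
  profile_tail w - profile_tail u <=
  3 / 2 * (Num.sqrt pi / sg) + expR 2 / sg ^+ 2.
Proof.
move=> sg1 u0 w0; rewrite /profile_tail.
have h1 := cdf_le w; have h2 := cdf_ge0 u.
have h3 : 0 <= u ^- 2 / sg ^+ 2 * profile u.
  by rewrite mulr_ge0 ?profile_ge0 // divr_ge0 ?invr_ge0 // exprn_ge0 // ltW.
suff h4 : w ^- 2 / sg ^+ 2 * profile w <= expR 2 / sg ^+ 2 by lra.
rewrite mulrAC ler_pM2r ?invr_gt0 ?exprn_gt0 //.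
have wN0 : w != 0 by rewrite gt_eqF.
have E : profile w <= expR (2 - w ^- 2).
  rewrite ler_expR /profile_arg.
  have h5 : (w - w^-1) ^+ 2 <= (sg * (w - w^-1)) ^+ 2.
    by rewrite exprMn ler_peMl ?sqr_ge0 // exprn_ege1.
  have h6 : (w - w^-1) ^+ 2 = w ^+ 2 + w ^- 2 - 2 by field.
  have := sqr_ge0 w; lra.
apply: le_trans (ler_wpM2l _ E) _; first by rewrite invr_ge0 sqr_ge0.
rewrite expRD mulrCA ler_piMr ?expR_ge0 //.
rewrite expRN -ler_pdivlMr ?invr_gt0 ?expR_gt0 // div1r invrK.
by have := expR_ge1Dx (w ^- 2); lra.
Qed.

Lemma expRNsqr_le (x : R) : 0 < x -> expR (- x ^+ 2) <= x^-1.
Proof.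
move=> x0; rewrite expRN lef_pV2 ?posrE ?expR_gt0 //.
have := expR_ge1Dx (x ^+ 2); have := sqr_ge0 (x - 1); nra.
Qed.

(** The two Gaussian tails cut off at [u] and [w] are bounded by inverses of [profile_arg], and so
    is the boundary term at [w]. The losses vanish as the arguments go to the two infinities. *)
Lemma profile_lower_total u w : 0 < u -> 0 < w ->
  profile_arg u < 0 -> 0 < profile_arg w ->
  (Num.sqrt pi + (profile_arg u)^-1) / sg -
    (sg^-1 + sg ^- 2) / profile_arg w <= profile_lower w - profile_lower u.
Proof.
move=> u0 w0 su sw; rewrite /profile_lower /profile_cdf.
have h1 := gauss_cdf_tail sw.
have h2 : gauss_cdf (profile_arg u) <= - (profile_arg u)^-1.
  have := @gauss_cdfN_le _ (- profile_arg u); rewrite opprK invrN.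
  by apply; rewrite oppr_gt0.
have h3 : 0 <= u / (u + 1) / sg ^+ 2 * profile u.
  rewrite mulr_ge0 ?profile_ge0 // divr_ge0 ?exprn_ge0 // ?ltW //.
  by rewrite divr_gt0 // addr_gt0.
have h4 : w / (w + 1) / sg ^+ 2 * profile w <= sg ^- 2 / profile_arg w.
  apply: ler_pM; rewrite ?profile_ge0 ?expRNsqr_le //.
    by rewrite divr_ge0 ?exprn_ge0 // ?divr_ge0 // ?addr_ge0 // ltW.
  rewrite ler_piMl ?invr_ge0 ?exprn_ge0 // 1?ltW //.
  by rewrite ltr_pdivrMr ?addr_gt0 // mul1r ltrDl.
have h5 : (Num.sqrt pi - (profile_arg w)^-1) / sg <= gauss_cdf (profile_arg w) / sg.
  by rewrite ler_pM2r ?invr_gt0.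
have h6 : gauss_cdf (profile_arg u) / sg <= - (profile_arg u)^-1 / sg.
  by rewrite ler_pM2r ?invr_gt0.
have h7 : sg^-1 / profile_arg w = (profile_arg w)^-1 / sg by rewrite mulrC.
lra.
Qed.

End gaussian_profile.

(** * The kernel of the moments *)

Section quotient_bounds.
Variable R : realType.
Implicit Types x z : R.

(* With z = 1 / (2 x + 1) one has (1 - z) / (1 + z) = x / (x + 1). *)
Lemma expR_atanh_le z : 0 <= z <= 1 -> (1 - z) * expR (2 * z) <= 1 + z.
Proof.
move=> /andP[z0 z1]; pose g (z : R) := 1 + z - (1 - z) * expR (2 * z).
have dg (t : R) : 0 <= t <= z -> is_derive t 1 g (1 - (1 - 2 * t) * expR (2 * t)).
  by move=> _; rewrite /g; der_by; ring.
(* This is 1 - s <= exp(-s) at s = 2 t. *)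
have g0 (t : R) : 0 <= t <= z -> 0 <= 1 - (1 - 2 * t) * expR (2 * t).
  move=> _; rewrite subr_ge0 -[leRHS](expRxMexpNx_1 (2 * t)) mulrC.
  rewrite ler_wpM2l ?expR_ge0 //.
  by have := expR_ge1Dx (- (2 * t)); lra.
have := derive_ge0_le z0 dg g0.
by rewrite /g mulr0 expR0; lra.
Qed.

(** The logarithm of (1 + z) / (1 - z) is 2 z + O(z^3). The generous coefficient 8 turns the cubic
    term into (x + 1/2)^-3; the derivative is bounded below through exp(s) >= 1 + s, leaving a
    polynomial inequality. *)
Lemma expR_atanh_ge z : 0 <= z <= 2^-1 ->
  1 + z <= (1 - z) * expR (2 * z + 8 * z ^+ 3).
Proof.
move=> /andP[z0 z1].
pose g (z : R) := (1 - z) * expR (2 * z + 8 * z ^+ 3) - (1 + z).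
have dg (t : R) : 0 <= t <= z -> is_derive t 1 g
    (((1 - t) * (2 + 24 * t ^+ 2) - 1) * expR (2 * t + 8 * t ^+ 3) - 1).
  by move=> _; rewrite /g; der_by; ring.
have g0 (t : R) : 0 <= t <= z ->
    0 <= ((1 - t) * (2 + 24 * t ^+ 2) - 1) * expR (2 * t + 8 * t ^+ 3) - 1.
  move=> /andP[t0 tz]; rewrite subr_ge0.
  have t1 : t <= 2^-1 by exact: le_trans z1.
  have h1 : 0 <= (1 - t) * (2 + 24 * t ^+ 2) - 1.
    have := sqr_ge0 t; nra.
  apply: (@le_trans _ _ (((1 - t) * (2 + 24 * t ^+ 2) - 1) * (1 + 2 * t))).
    have h2 : 0 <= t ^+ 2 * (1 - 2 * t) by rewrite mulr_ge0 ?sqr_ge0 //; lra.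
    have h3 : 0 <= t ^+ 3 * (1 - 2 * t) by rewrite mulr_ge0 ?exprn_ge0 //; lra.
    have h4 := sqr_ge0 t; lra.
  rewrite ler_wpM2l //; apply: le_trans (expR_ge1Dx _).
  have := exprn_ge0 3 t0; lra.
have := derive_ge0_le z0 dg g0.
by rewrite /g mulr0 expr0n mulr0 addr0 expR0; lra.
Qed.

Lemma quotient_le x : 0 <= x -> x / (x + 1) <= expR (- (x + 2^-1)^-1).
Proof.
move=> x0; pose z := (2 * x + 1)^-1.
have y0 : 0 < 2 * x + 1 by lra.
have z01 : 0 <= z <= 1 by rewrite invr_ge0 ltW //= invf_le1 //; lra.
have := expR_atanh_le z01.
have -> : 2 * z = (x + 2^-1)^-1 by rewrite /z; field; rewrite !gt_eqF //; lra.
have x10 : 0 < x + 1 by lra.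
rewrite expRN ler_pdivrMr //.
have -> : 1 - z = 2 * x / (2 * x + 1) by rewrite /z; field; rewrite gt_eqF.
have -> : 1 + z = 2 * (x + 1) / (2 * x + 1) by rewrite /z; field; rewrite gt_eqF.
rewrite mulrAC ler_pM2r ?invr_gt0 // mulrAC -!mulrA ler_pM2l // => h.
by rewrite ler_pdivlMl ?expR_gt0 // mulrC.
Qed.

Lemma quotient_ge x : 2^-1 <= x ->
  expR (- ((x + 2^-1)^-1 + (x + 2^-1) ^- 3)) <= x / (x + 1).
Proof.
move=> x2; pose z := (2 * x + 1)^-1.
have y0 : 0 < 2 * x + 1 by lra.
have z01 : 0 <= z <= 2^-1.
  by rewrite invr_ge0 ltW //= lef_pV2 ?posrE //; lra.
have := expR_atanh_ge z01.
have -> : 2 * z + 8 * z ^+ 3 = (x + 2^-1)^-1 + (x + 2^-1) ^- 3.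
  by rewrite /z; field; rewrite !gt_eqF //; lra.
have x10 : 0 < x + 1 by lra.
rewrite expRN ler_pdivlMr //.
have -> : 1 - z = 2 * x / (2 * x + 1) by rewrite /z; field; rewrite gt_eqF.
have -> : 1 + z = 2 * (x + 1) / (2 * x + 1) by rewrite /z; field; rewrite gt_eqF.
rewrite [leRHS]mulrAC ler_pM2r ?invr_gt0 // -!mulrA ler_pM2l // => h.
by rewrite ler_pdivrMl ?expR_gt0 // mulrC.
Qed.

End quotient_bounds.

Section moment_kernel.
Variables (R : realType) (l q : R) (k : nat).
Hypotheses (l0 : 0 < l) (q0 : 0 < q) (qk : q ^+ 4 = k.+2%:R).
Implicit Types x : R.

Definition ratio x : R := x / (x + 1).
(** Writing L = k + 2 keeps the exponents of [ratio] natural numbers through two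
    differentiations. *)
Definition kernel x := ratio x ^+ k.+2 * expR (- (l ^+ 4 * x)).
Definition kernel1 x :=
  (k.+2%:R * ratio x ^+ k.+1 * (x + 1) ^- 2 - l ^+ 4 * ratio x ^+ k.+2) *
  expR (- (l ^+ 4 * x)).
Definition kernel2 x :=
  (((k.+2%:R * (x + 1) ^- 2 - l ^+ 4 * ratio x) ^+ 2 -
    k.+2%:R * ((1 + 2 * x) / (x + 1) ^+ 4)) * ratio x ^+ k) *
  expR (- (l ^+ 4 * x)).
(* scale x = w sends the saddle point of the kernel close to w = 1. *)
Definition scale x := l / q * Num.sqrt (x + 2^-1).

Let ratio_itv x : 0 <= x -> 0 <= ratio x <= 1.
Proof.
move=> x0; rewrite /ratio divr_ge0 ?addr_ge0 //=.
by rewrite ler_pdivrMr ?ltr_wpDl // mul1r lerDl.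
Qed.

Lemma der_ratio x : 0 <= x -> is_derive x 1 ratio ((x + 1) ^- 2).
Proof.
move=> x0; have x1 : x + 1 != 0 by rewrite gt_eqF // ltr_wpDl.
by rewrite /ratio; der_by; field.
Qed.

Lemma der_kernel x : 0 <= x -> is_derive x 1 kernel (kernel1 x).
Proof.
move=> x0; have x1 : x + 1 != 0 by rewrite gt_eqF // ltr_wpDl.
have dr := der_ratio x0.
rewrite /kernel /kernel1; der_by; rewrite !(exprS (ratio x)); field.
by rewrite x1.
Qed.

Lemma der_kernel1 x : 0 <= x -> is_derive x 1 kernel1 (kernel2 x).
Proof.
move=> x0; have x1 : x + 1 != 0 by rewrite gt_eqF // ltr_wpDl.
have x2 : (x + 1) ^+ 2 != 0 by rewrite expf_neq0.
have dr := der_ratio x0.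
rewrite /kernel1 /kernel2; der_by; rewrite !(exprS (ratio x)) -!(natr1 k.+1).
rewrite [in LHS]/ratio -/(ratio x).
(* The first summand completes L (L - 1) to L^2 in the square; the second comes from differentiating
   (x + 1)^-2. *)
have E : (1 + 2 * x) / (x + 1) ^+ 4 = (x + 1) ^- 4 + 2 * ratio x / (x + 1) ^+ 3.
  by rewrite /ratio; field.
by rewrite E; field.
Qed.

Lemma der_scale x : 0 <= x -> is_derive x 1 scale ((l / q) ^+ 2 / (2 * scale x)).
Proof.
move=> x0; have y0 : 0 < x + 2^-1 by rewrite ltr_wpDl.
have s0 : Num.sqrt (x + 2^-1) != 0 by rewrite gt_eqF // sqrtr_gt0.
have lq0 : l / q != 0 by rewrite gt_eqF // divr_gt0.
have ds : is_derive x 1 (fun x => Num.sqrt (x + 2^-1)) ((2 * Num.sqrt (x + 2^-1))^-1 * 1).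
  have d1 : is_derive x 1 (fun x : R => x + 2^-1) 1 by der_by; rewrite addr0.
  exact (@der_comp _ (@Num.sqrt R) (fun x => x + 2^-1) x _ _ (is_derive1_sqrt y0) d1).
rewrite /scale; der_by.
by field; rewrite s0 !gt_eqF.
Qed.

Lemma scale_gt0 x : 0 <= x -> 0 < scale x.
Proof. by move=> x0; rewrite mulr_gt0 ?divr_gt0 // sqrtr_gt0 ltr_wpDl. Qed.

Lemma scale_sqr x : 0 <= x -> scale x ^+ 2 = (l / q) ^+ 2 * (x + 2^-1).
Proof. by move=> x0; rewrite exprMn sqr_sqrtr // addr_ge0. Qed.

(** For l^4 = ln 2 this is sqrt 2 * C^(sqrt L): the shift by 1/2 gives the first factor, the value
    at the saddle point the second. *)
Definition amplitude := expR (l ^+ 4 / 2 - 2 * (l * q) ^+ 2).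
Local Notation amp := amplitude.
Local Notation prof x := (profile (l * q) (scale x)).

Let lq0 : 0 < l * q. Proof. exact: mulr_gt0. Qed.

Let xhalf x : 0 <= x -> 0 < x + 2^-1. Proof. lra. Qed.

(** Completing the square: with y = x + 1/2, (l q)^2 (w - 1/w)^2 = l^4 y + q^4 / y - 2 (l q)^2. *)
Lemma profile_scale x : 0 <= x ->
  amp * prof x = expR (- (l ^+ 4 * x)) * expR (- (k.+2%:R / (x + 2^-1))).
Proof.
move=> x0; rewrite /amp /profile -!expRD; congr expR.
have w0 := scale_gt0 x0; have w2 := scale_sqr x0.
have y0 := xhalf x0.
have -> : profile_arg (l * q) (scale x) ^+ 2 =
    (l * q) ^+ 2 * (scale x ^+ 2 - 2 + (scale x ^+ 2)^-1).
  by rewrite /profile_arg; field; rewrite gt_eqF.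
by rewrite w2 -qk; field; rewrite !gt_eqF //; lra.
Qed.

Let ratio_exp_le n x : 0 <= x -> ratio x ^+ n <= expR (- (n%:R / (x + 2^-1))).
Proof.
move=> x0; rewrite -mulrN expRM_natl.
have /andP[r0 _] := ratio_itv x0.
by rewrite lerXn2r ?nnegrE ?expR_ge0 // quotient_le.
Qed.

Lemma kernel_le x : 0 <= x -> kernel x <= amp * prof x.
Proof.
move=> x0; rewrite profile_scale // /kernel mulrC ler_wpM2l ?expR_ge0 //.
exact: ratio_exp_le.
Qed.

(* The bound is vacuous for x < 1/2, where L / (x + 1/2)^3 >= 1. *)
Lemma kernel_ge x : 0 <= x ->
  amp * prof x * (1 - k.+2%:R / (x + 2^-1) ^+ 3) <= kernel x.
Proof.
move=> x0; have y0 := xhalf x0.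
have /andP[r0 _] := ratio_itv x0.
have k1 : 1 <= k.+2%:R :> R by rewrite ler1n.
have [x2|x2] := leP 2^-1 x; last first.
  apply: (@le_trans _ _ 0); last by rewrite mulr_ge0 ?exprn_ge0 ?expR_ge0.
  rewrite mulr_ge0_le0 // ?mulr_ge0 ?expR_ge0 // subr_le0.
  rewrite ler_pdivlMr ?exprn_gt0 // mul1r (le_trans _ k1) //.
  by rewrite exprn_ile1 ?ltW //; lra.
rewrite profile_scale // /kernel -mulrA mulrC ler_wpM2r ?expR_ge0 //.
apply: (@le_trans _ _ (expR (- (k.+2%:R / (x + 2^-1))) * expR (- (k.+2%:R / (x + 2^-1) ^+ 3)))).
  by rewrite ler_wpM2l ?expR_ge0 // expR_ge1Dx.
rewrite -expRD -opprD -mulrDr -mulrN expRM_natl.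
by rewrite lerXn2r ?nnegrE ?expR_ge0 // quotient_ge.
Qed.

(** The factor (q / l)^2 comes from dx = 2 (q / l)^2 w dw, which also explains the weight 2 w in the
    profile bounds. *)
Let upper x := amp * (q / l) ^+ 2 * profile_upper (l * q) (scale x).

Let der_upper x : 0 <= x -> is_derive x 1 upper
  (amp / (2 * scale x) * (prof x *
     (scale x ^+ 2 + 1 + scale x ^- 2 / (2 * (l * q) ^+ 2)))).
Proof.
move=> x0; have w0 := scale_gt0 x0.
have d := der_comp (der_profile_upper lq0 w0) (der_scale x0).
by rewrite /upper; der_by; field; rewrite !gt_eqF.
Qed.

Let upper_ge x : 0 <= x -> kernel x <= amp / (2 * scale x) * (prof x *
  (scale x ^+ 2 + 1 + scale x ^- 2 / (2 * (l * q) ^+ 2))).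
Proof.
move=> x0; have w0 := scale_gt0 x0; apply: le_trans (kernel_le x0) _.
apply: le_trans (ler_wpM2l _ (profile_upper_ge lq0 w0)).
  by rewrite le_eqVlt; apply/orP; left; apply/eqP; field; rewrite gt_eqF.
by rewrite divr_ge0 ?expR_ge0 // mulr_ge0 // ltW.
Qed.

(** The subtracted tail pays for the loss L / y^3 in [kernel_ge]: it equals L (l / q)^6 w^-6, and
    the weight 2 w turns this into 2 L (l / q)^6 w^-5. *)
Let lower x := amp * (q / l) ^+ 2 * (profile_lower (l * q) (scale x) -
  2 * k.+2%:R * (l / q) ^+ 6 * profile_tail (l * q) (scale x)).

Let lower_der x := amp / (2 * scale x) *
  (prof x * (2 * scale x - (1 - (scale x)^-1) ^+ 2 -
     ((l * q) ^+ 2 * (scale x + 1) ^+ 2)^-1) -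
   2 * k.+2%:R * (l / q) ^+ 6 * (prof x * (3 / 2 * (1 + scale x ^- 2) -
     2 * scale x ^- 3 / (l * q) ^+ 2 + 2 * (scale x ^- 5 - (scale x)^-1)))).

Let der_lower x : 0 <= x -> is_derive x 1 lower (lower_der x).
Proof.
move=> x0; have w0 := scale_gt0 x0.
have d1 := der_comp (der_profile_lower lq0 w0) (der_scale x0).
have d2 := der_comp (der_profile_tail lq0 w0) (der_scale x0).
rewrite /lower /lower_der; der_by.
have w1 : scale x + 1 != 0 by rewrite gt_eqF // addr_gt0.
by field; rewrite w1 !gt_eqF.
Qed.

Hypothesis lq1 : 1 <= l * q.

Let scale3 x : 0 <= x -> (l / q) ^+ 6 * scale x ^- 6 = (x + 2^-1) ^- 3.
Proof.
move=> x0; have y0 := xhalf x0.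
rewrite (_ : scale x ^- 6 = (scale x ^+ 2) ^- 3); last by rewrite -exprM.
by rewrite scale_sqr //; field; rewrite !gt_eqF //; lra.
Qed.

Let lower_le x : 0 <= x -> lower_der x <= kernel x.
Proof.
move=> x0; have w0 := scale_gt0 x0; apply: le_trans (kernel_ge x0).
have h1 := @profile_lower_le _ (l * q) _ w0.
have h2 := profile_tail_ge lq0 lq1 w0.
have c0 : 0 <= 2 * k.+2%:R * (l / q) ^+ 6.
  by rewrite mulr_ge0 // exprn_ge0 // divr_ge0 // ltW.
have h3 := ler_wpM2l c0 h2.
have a0 : 0 <= amp / (2 * scale x).
  by rewrite divr_ge0 ?expR_ge0 // mulr_ge0 // ltW.
apply: (le_trans (ler_wpM2l a0 (lerB h1 h3))).
rewrite -(scale3 x0) le_eqVlt; apply/orP; left; apply/eqP.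
by field; rewrite !gt_eqF.
Qed.

(** Chosen so that the tail term in [dom_der] dominates 4 L e^4 y^-3 times [amp] times the profile,
    which bounds twice the negative part split off from [kernel2]. *)
Let tail_coef := 8 * l ^+ 4 * expR 4 * amp.
Let dom x := kernel1 x + tail_coef * profile_tail (l * q) (scale x).
Let dom_der x := kernel2 x + tail_coef * ((prof x * (3 / 2 * (1 + scale x ^- 2) -
     2 * scale x ^- 3 / (l * q) ^+ 2 + 2 * (scale x ^- 5 - (scale x)^-1))) *
     ((l / q) ^+ 2 / (2 * scale x))).

Let der_dom x : 0 <= x -> is_derive x 1 dom (dom_der x).
Proof.
move=> x0; have w0 := scale_gt0 x0.
have d1 := der_kernel1 x0.
have d2 := der_comp (der_profile_tail lq0 w0) (der_scale x0).
by rewrite /dom /dom_der; der_by; rewrite mul0r add0r.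
Qed.

(* kernel2 = square - B with B >= 0, so |kernel2| <= kernel2 + 2 B, and the
   first term integrates to the boundary values of kernel1. *)
Let kernel2_le x : 0 <= x -> `|kernel2 x| <= dom_der x.
Proof.
move=> x0; have y0 := xhalf x0; have w0 := scale_gt0 x0.
have /andP[r0 _] := ratio_itv x0.
pose B := k.+2%:R * ((1 + 2 * x) / (x + 1) ^+ 4) * (ratio x ^+ k * expR (- (l ^+ 4 * x))).
have x10 : 0 < x + 1 by rewrite ltr_wpDl.
have e0 : 0 <= ratio x ^+ k * expR (- (l ^+ 4 * x)).
  by rewrite mulr_ge0 ?exprn_ge0 ?expR_ge0.
have B0 : 0 <= B.
  by rewrite mulr_ge0 // mulr_ge0 // divr_ge0 ?exprn_ge0 ?addr_ge0 ?mulr_ge0.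
have kB : - B <= kernel2 x.
  have -> : kernel2 x = (k.+2%:R * (x + 1) ^- 2 - l ^+ 4 * ratio x) ^+ 2 *
      (ratio x ^+ k * expR (- (l ^+ 4 * x))) - B.
    by rewrite /kernel2 /B; ring.
  by rewrite -[X in X <= _]add0r lerD2r mulr_ge0 ?sqr_ge0.
have T : 2 * B <= tail_coef * ((prof x * (3 / 2 * (1 + scale x ^- 2) -
     2 * scale x ^- 3 / (l * q) ^+ 2 + 2 * (scale x ^- 5 - (scale x)^-1))) *
     ((l / q) ^+ 2 / (2 * scale x))).
  have h : 0 <= (l / q) ^+ 2 / (2 * scale x).
    by rewrite divr_ge0 ?sqr_ge0 // mulr_ge0 // ltW.
  have t0 : 0 <= tail_coef by rewrite !mulr_ge0 ?exprn_ge0 ?expR_ge0 // ltW.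
  apply: le_trans (ler_wpM2l t0 (ler_wpM2r h (profile_tail_ge lq0 lq1 w0))).
  have -> : tail_coef * (scale x ^- 5 * prof x * ((l / q) ^+ 2 / (2 * scale x))) =
      4 * k.+2%:R * (x + 2^-1) ^- 3 * (expR 4 * (amp * prof x)).
    rewrite -(scale3 x0) -qk /tail_coef; field.
    by rewrite !gt_eqF.
  have h1 : (1 + 2 * x) / (x + 1) ^+ 4 <= 2 * (x + 2^-1) ^- 3.
    apply: (@le_trans _ _ (2 * (x + 1) ^- 3)); last first.
      rewrite ler_pM2l // lef_pV2 ?posrE ?exprn_gt0 //.
      by apply: lerXn2r; rewrite ?nnegrE; lra.
    rewrite -subr_ge0 (_ : _ - _ = (x + 1) ^- 4); last by field; rewrite gt_eqF.
    by rewrite invr_ge0 exprn_ge0 // ltW.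
  have h2 : ratio x ^+ k * expR (- (l ^+ 4 * x)) <= expR 4 * (amp * prof x).
    rewrite profile_scale // mulrCA mulrC ler_wpM2l ?expR_ge0 //.
    apply: le_trans (ratio_exp_le k x0) _.
    rewrite -expRD ler_expR -(natr1 k.+1) -(natr1 k).
    (* Passing from the power k of [ratio] to L = k + 2 costs exp(2 / y), at most e^4 since y >=
       1/2. *)
    have : (x + 2^-1)^-1 <= 2 by rewrite -[leRHS]invrK lef_pV2 ?posrE //; lra.
    by rewrite !mulrDl; lra.
  have -> : 4 * k.+2%:R * (x + 2^-1) ^- 3 * (expR 4 * (amp * prof x)) =
    2 * (k.+2%:R * (2 * (x + 2^-1) ^- 3) * (expR 4 * (amp * prof x))) by ring.
  rewrite ler_pM2l // /B ler_pM //.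
    by rewrite mulr_ge0 // divr_ge0 ?exprn_ge0 ?addr_ge0 ?mulr_ge0.
  by rewrite ler_wpM2l.
by rewrite /dom_der ler_norml; lra.
Qed.

Let shift_sum_upper N t : 0 <= t <= 1 -> shift_sum kernel N t <=
  upper N%:R - upper 0 + (`|kernel N%:R - kernel 0| + (dom N%:R - dom 0)).
Proof.
exact (@shift_sum_le R kernel kernel1 kernel2 dom dom_der der_kernel der_kernel1
  der_dom kernel2_le upper _ N t der_upper upper_ge).
Qed.

Let shift_sum_lower N t : 0 <= t <= 1 -> lower N%:R - lower 0 -
  (`|kernel N%:R - kernel 0| + (dom N%:R - dom 0)) <= shift_sum kernel N t.
Proof.
exact (@shift_sum_ge R kernel kernel1 kernel2 dom dom_der der_kernel der_kernel1
  der_dom kernel2_le lower lower_der N t der_lower lower_le).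
Qed.

Definition tail_total := 3 / 2 * (Num.sqrt pi / l) + expR 2 / l ^+ 2.
Local Notation T := tail_total.
(** In order: the excess factor in [profile_upper]; boundary terms at x = 0, 1/2 from above and 2
    from below; the cubic error in [lower]; the oscillation of the shifted sum. *)
Definition estimate_const := Num.sqrt pi / (2 * l ^+ 5) + 5 / (2 * l ^+ 3) +
  2 * l ^+ 4 * T + 8 * l ^+ 4 * expR 4 * T.
Local Notation C := estimate_const.

Hypotheses (q1 : 1 <= q) (lq2 : 2 * l ^+ 2 <= q ^+ 2).

Let lN0 : l != 0. Proof. by rewrite gt_eqF. Qed.
Let qN0 : q != 0. Proof. by rewrite gt_eqF. Qed.
Let amp0 : 0 < amp. Proof. exact: expR_gt0. Qed.
Let pi0 : 0 <= Num.sqrt pi :> R. Proof. exact: sqrtr_ge0. Qed.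

Let T0 : 0 <= T.
Proof.
have l0' := ltW l0.
by rewrite /tail_total addr_ge0 // ?mulr_ge0 // ?invr_ge0 ?expR_ge0 ?exprn_ge0.
Qed.

Let tail_le (N : nat) : profile_tail (l * q) (scale N%:R) -
  profile_tail (l * q) (scale 0) <= T / q.
Proof.
apply: le_trans (profile_tail_total lq0 lq1 (scale_gt0 _) (scale_gt0 _)) _ => //.
rewrite /tail_total [leRHS]mulrDl; apply: lerD.
  by rewrite le_eqVlt; apply/orP; left; apply/eqP; field; rewrite ?lN0 ?qN0.
rewrite -mulrA ler_wpM2l ?expR_ge0 // exprMn invfM ler_pM2l ?invr_gt0 ?exprn_gt0 //.
by rewrite lef_pV2 ?posrE ?exprn_gt0 // expr2 ler_peMl // ltW.
Qed.

Let ratio_0 n : ratio 0 ^+ n.+1 = 0.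
Proof. by rewrite /ratio mul0r expr0n. Qed.

Let kernel_0 : kernel 0 = 0.
Proof. by rewrite /kernel ratio_0 mul0r. Qed.

Let kernel1_0 : kernel1 0 = 0.
Proof. by rewrite /kernel1 !ratio_0 !mulr0 mul0r subrr mul0r. Qed.

Let kernel_decay x : 0 <= x ->
  `|kernel x| + kernel1 x <= (1 + k.+2%:R + l ^+ 4) * expR (- (l ^+ 4 * x)).
Proof.
move=> x0; have /andP[r0 r1] := ratio_itv x0.
have p0 n : 0 <= ratio x ^+ n by rewrite exprn_ge0.
have p1 n : ratio x ^+ n <= 1 by rewrite exprn_ile1.
have e0 := expR_ge0 (- (l ^+ 4 * x)).
rewrite ger0_norm; last by rewrite mulr_ge0.
rewrite /kernel /kernel1 -mulrDl ler_wpM2r //.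
have h1 : k.+2%:R * ratio x ^+ k.+1 * (x + 1) ^- 2 <= k.+2%:R.
  rewrite -mulrA ler_piMr // mulr_ile1 ?invr_ge0 ?sqr_ge0 //.
  by rewrite invf_le1 ?exprn_gt0 ?ltr_wpDl // exprn_ege1 // lerDr.
have h2 : 0 <= l ^+ 4 * ratio x ^+ k.+2 by rewrite mulr_ge0 // exprn_ge0 // ltW.
have h3 : 0 <= l ^+ 4 by rewrite exprn_ge0 // ltW.
have := p1 k.+2; lra.
Qed.

(** The range of w starts at [scale 0] instead of 0; this shows that the Gaussian mass missed on the
    left is only of order q^-2. *)
Let arg_0 : profile_arg (l * q) (scale 0) <= - (q ^+ 2 / 2).
Proof.
rewrite /profile_arg /scale add0r; set h := Num.sqrt 2^-1.
have h0 : 0 < h by rewrite sqrtr_gt0.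
have hN0 : h != 0 by rewrite gt_eqF.
have h1 : h <= 1 by rewrite -sqrtr1 ler_sqrt //; lra.
have -> : l * q * (l / q * h - (l / q * h)^-1) = l ^+ 2 * h - q ^+ 2 / h.
  by field; rewrite ?lN0 ?qN0 ?hN0.
have h2 : l ^+ 2 * h <= l ^+ 2 by rewrite ler_piMr // exprn_ge0 // ltW.
have h3 : q ^+ 2 <= q ^+ 2 / h by rewrite ler_peMr ?sqr_ge0 // invf_ge1.
apply: (le_trans (lerB h2 h3)); move: lq2; lra.
Qed.

Let scale_0 : scale 0 <= l / q.
Proof.
have h : Num.sqrt (0 + 2^-1) <= 1 :> R by rewrite -[leRHS]sqrtr1 ler_sqrt //; lra.
by rewrite /scale ler_piMr // divr_ge0 // ltW.
Qed.

Let expR_decay y : 0 < y -> expR (- y) <= y^-1 :> R.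
Proof.
move=> y0; rewrite expRN lef_pV2 ?posrE ?expR_gt0 //.
by apply: le_trans (expR_ge1Dx y); lra.
Qed.

Let near_decay (e : R) : 0 < e ->
  \forall N \near \oo, expR (- (l ^+ 4 * N%:R)) <= e.
Proof.
move=> e0; near=> N.
have N0 : 0 < N%:R :> R by rewrite ltr0n; near: N; exact: nbhs_infty_gt.
have l4 : 0 < l ^+ 4 by rewrite exprn_gt0.
apply: le_trans (expR_decay _) _; first by rewrite mulr_gt0.
rewrite -[leRHS]invrK lef_pV2 ?posrE ?invr_gt0 ?mulr_gt0 //.
rewrite -ler_pdivrMl //.
near: N; exact: nbhs_infty_ger.
Unshelve. all: by end_near. Qed.

Let near_arg (M : R) : \forall N \near \oo, M <= profile_arg (l * q) (scale N%:R).
Proof.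
pose W := 1 + `|M| / (l * q).
have W1 : 1 <= W by rewrite lerDl divr_ge0 // ltW.
have W0 : 0 < W by apply: lt_le_trans W1.
near=> N.
have WN : W <= scale N%:R.
  have w0N : 0 <= scale N%:R by rewrite ltW // scale_gt0.
  rewrite -(@ler_pXn2r _ 2) ?nnegrE // ?(ltW W0) // scale_sqr //.
  have l2 : 0 < (l / q) ^+ 2 by rewrite exprn_gt0 // divr_gt0.
  rewrite -ler_pdivrMl //.
  apply: (@le_trans _ _ N%:R); last by rewrite lerDl.
  near: N; exact: nbhs_infty_ger.
have w1 := le_trans W1 WN.
have iw : (scale N%:R)^-1 <= 1 by rewrite invf_le1 // (lt_le_trans ltr01).
rewrite /profile_arg; apply: (@le_trans _ _ (l * q * (W - 1))).
  rewrite /W addrC addKr mulrC divfK ?gt_eqF //.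
  exact: ler_norm.
rewrite ler_pM2l //; lra.
Unshelve. all: by end_near. Qed.

(** The main term is the full Gaussian mass, amp (q / l)^2 sqrt(pi) / (l q). Everything else is
    O(amp / q), apart from contributions at x = N, absorbed in [e]. *)
Lemma kernel_sum_estimate (e : R) : 0 < e -> \forall N \near \oo,
  forall t, 0 <= t <= 1 ->
  `|shift_sum kernel N t - amp * (Num.sqrt pi * q / l ^+ 3)| <= C * (amp / q) + e.
Proof.
move=> e0.
have K1 : 0 < 1 + k.+2%:R + l ^+ 4 by rewrite addr_gt0 ?exprn_gt0.
have e1 : 0 < (1 + k.+2%:R + l ^+ 4)^-1 * (e / 2).
  by rewrite mulr_gt0 ?invr_gt0 // divr_gt0.
near=> N => t t01.
have K2 : 0 < amp * (q / l) ^+ 2 * ((l * q)^-1 + (l * q) ^- 2).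
  have h : 0 < amp * (q / l) ^+ 2 by rewrite mulr_gt0 // exprn_gt0 // divr_gt0.
  by rewrite mulr_gt0 // addr_gt0 ?invr_gt0 ?exprn_gt0.
have N0 : 0 <= N%:R :> R by [].
have h1 : `|kernel N%:R| + kernel1 N%:R <= e / 2.
  apply: le_trans (kernel_decay N0) _; rewrite -ler_pdivlMl //.
  by near: N; exact: near_decay.
(* N is so large that the loss at the right end in [profile_lower_total] is at most e / 2. *)
have h2' : 2 * (amp * (q / l) ^+ 2 * ((l * q)^-1 + (l * q) ^- 2)) / e <=
    profile_arg (l * q) (scale N%:R).
  near: N; exact: near_arg.
have sN : 0 < profile_arg (l * q) (scale N%:R).
  by apply: lt_le_trans h2'; rewrite divr_gt0 // mulr_gt0.
have h2 : amp * (q / l) ^+ 2 * (((l * q)^-1 + (l * q) ^- 2) /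
    profile_arg (l * q) (scale N%:R)) <= e / 2.
  rewrite mulrA ler_pdivrMr //; move: h2'; rewrite ler_pdivrMr //; lra.
have [l0' q0' a0'] : [/\ 0 <= l, 0 <= q & 0 <= amp] by split; exact: ltW.
have tc0 : 0 <= tail_coef by rewrite !mulr_ge0 ?exprn_ge0 ?expR_ge0.
have osc : `|kernel N%:R - kernel 0| + (dom N%:R - dom 0) <= e / 2 + tail_coef * (T / q).
  rewrite kernel_0 subr0 /dom kernel1_0 add0r.
  have := ler_wpM2l tc0 (tail_le N); lra.
have tcE : tail_coef * (T / q) = 8 * l ^+ 4 * expR 4 * T * (amp / q).
  by rewrite /tail_coef; field.
have T1 : 0 <= 2 * l ^+ 4 * T * (amp / q).
  by rewrite !mulr_ge0 ?exprn_ge0 ?invr_ge0.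
have P1 : 0 <= Num.sqrt pi / (2 * l ^+ 5) * (amp / q).
  by rewrite !mulr_ge0 ?invr_ge0 ?mulr_ge0 ?exprn_ge0.
have P2 : 0 <= (l ^+ 3)^-1 * (amp / q).
  by rewrite !mulr_ge0 ?invr_ge0 ?exprn_ge0.
have CE : C * (amp / q) = Num.sqrt pi / (2 * l ^+ 5) * (amp / q) +
    5 / 2 * ((l ^+ 3)^-1 * (amp / q)) + 2 * l ^+ 4 * T * (amp / q) +
    tail_coef * (T / q).
  by rewrite tcE /estimate_const; field; rewrite ?lN0 ?qN0.
have A0 : 0 <= amp * (q / l) ^+ 2 by rewrite mulr_ge0 ?sqr_ge0 // ltW.
have up : upper N%:R - upper 0 <= amp * (Num.sqrt pi * q / l ^+ 3) +
    Num.sqrt pi / (2 * l ^+ 5) * (amp / q) + 1 / 2 * ((l ^+ 3)^-1 * (amp / q)).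
  rewrite /upper -mulrBr.
  have := profile_upper_total lq0 (scale_gt0 (lexx 0)) (scale_gt0 N0).
  move=> /(ler_wpM2l A0) /le_trans; apply.
  apply: (@le_trans _ _ (amp * (q / l) ^+ 2 * ((1 + (2 * (l * q) ^+ 2)^-1) *
     (Num.sqrt pi / (l * q)) + l / q / (2 * (l * q) ^+ 2)))).
    rewrite ler_wpM2l // lerD2l ler_pM2r ?scale_0 //.
    by rewrite invr_gt0 mulr_gt0 // exprn_gt0.
  by rewrite le_eqVlt; apply/orP; left; apply/eqP; field; rewrite ?lN0 ?qN0.
have low : amp * (Num.sqrt pi * q / l ^+ 3) - 2 * ((l ^+ 3)^-1 * (amp / q)) -
    e / 2 - 2 * l ^+ 4 * T * (amp / q) <= lower N%:R - lower 0.
  have s0 : profile_arg (l * q) (scale 0) < 0.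
    by apply: le_lt_trans arg_0 _; rewrite oppr_lt0 divr_gt0 // exprn_gt0.
  have i0 : - (2 / q ^+ 2) <= (profile_arg (l * q) (scale 0))^-1.
    rewrite lerNl -invrN -[leRHS]invrK lef_pV2 ?posrE ?oppr_gt0 //.
      by rewrite invf_div lerNr.
    by rewrite invr_gt0 divr_gt0 // exprn_gt0.
  have h3 := profile_lower_total lq0 (scale_gt0 (lexx 0)) (scale_gt0 N0) s0 sN.
  have h4 : (Num.sqrt pi - 2 / q ^+ 2) / (l * q) <=
      (Num.sqrt pi + (profile_arg (l * q) (scale 0))^-1) / (l * q).
    by rewrite ler_pM2r ?invr_gt0 // lerD2l.
  have h5 := ler_wpM2l A0 h3.
  have h6 := ler_wpM2l A0 h4.
  have B0 : 0 <= amp * (q / l) ^+ 2 * (2 * k.+2%:R * (l / q) ^+ 6).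
    by rewrite mulr_ge0 // mulr_ge0 // exprn_ge0 // divr_ge0 // ltW.
  have h7 := ler_wpM2l B0 (tail_le N).
  have E1 : amp * (q / l) ^+ 2 * ((Num.sqrt pi - 2 / q ^+ 2) / (l * q)) =
      amp * (Num.sqrt pi * q / l ^+ 3) - 2 * ((l ^+ 3)^-1 * (amp / q)).
    by field; rewrite ?lN0 ?qN0.
  have E2 : amp * (q / l) ^+ 2 * (2 * k.+2%:R * (l / q) ^+ 6) * (T / q) =
      2 * l ^+ 4 * T * (amp / q).
    by rewrite -qk; field; rewrite ?lN0 ?qN0.
  rewrite E1 in h6; rewrite E2 in h7; rewrite /lower; lra.
have := shift_sum_upper N t01; have := shift_sum_lower N t01.
rewrite ler_norml CE; lra.
Unshelve. all: by end_near. Qed.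

End moment_kernel.

(** * Asymptotics of the moments *)

Lemma powR_inv4 (R : realType) (x y : R) : 0 <= x -> x ^+ 4 = y -> y `^ 4^-1 = x.
Proof.
move=> x0 <-; rewrite -powR_mulrn // -powRrM divff ?pnatr_eq0 // powRr1 //.
Qed.

Section moment_asymptotics.
Variable R : realType.
Local Notation F := (@mink R).
Local Notation mu := (lebesgue_stieltjes_measure (@mink R)).

Lemma mink_moment_unit_interval L :
  mink_moment R L = 2 * \int[mu]_(x in `[0, 1]) x ^+ L.
Proof.
rewrite /mink_moment /Rintegral mink_moment_half fineM //.
apply: integrable_fin_num => //.
apply: (@mink_integrable_bounded R _ (fun x => x ^+ L) 1) => //.
move=> x /=; rewrite in_itv /= => /andP[x0 x1].
by rewrite ger0_norm ?exprn_ge0 // exprn_ile1.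
Qed.

Let l : R := Num.sqrt (Num.sqrt (ln 2)).

Let ln2_gt0 : 0 < ln 2 :> R. Proof. by rewrite ln_gt0 // ltr1n. Qed.
Let l0 : 0 < l. Proof. by rewrite !sqrtr_gt0. Qed.
Let l2 : l ^+ 2 = Num.sqrt (ln 2).
Proof. by rewrite sqr_sqrtr // sqrtr_ge0. Qed.
Let l4 : l ^+ 4 = ln 2.
Proof. by rewrite (exprM l 2 2) l2 sqr_sqrtr // ltW. Qed.

Let root L : R := Num.sqrt (Num.sqrt L%:R).

Let root2 L : root L ^+ 2 = Num.sqrt L%:R.
Proof. by rewrite sqr_sqrtr // sqrtr_ge0. Qed.
Let root4 L : root L ^+ 4 = L%:R.
Proof. by rewrite (exprM (root L) 2 2) root2 sqr_sqrtr. Qed.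

Let amplitudeE L : amplitude l (root L) = Num.sqrt 2 * mink_C R `^ Num.sqrt L%:R.
Proof.
rewrite /amplitude expRD l4 exprMn l2 root2; congr (_ * _).
  by rewrite -powR12_sqrt // powR2_expR.
rewrite /powR /mink_C gt_eqF ?expR_gt0 // expRK; congr expR; ring.
Qed.

Lemma mink_moment_estimate k : let q := root k.+2 in
  1 <= q -> 1 <= l * q -> 2 * l ^+ 2 <= q ^+ 2 ->
  `|mink_moment R k.+2 -
    amplitude l q * (Num.sqrt pi * q / l ^+ 3) * (ln 2 * Psi_mean R)| <=
  estimate_const l * (amplitude l q / q) * (ln 2 * Psi_mean R).
Proof.
move=> q q1 lq1 lq2; have q0 : 0 < q by exact: lt_le_trans q1.
(* With absolute values the integrand lies in [0,1] on the whole line. *)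
pose h (x : R) := (`|x| / (`|x| + 1)) ^+ k.+2.
have -> : mink_moment R k.+2 = \int[mu]_(x in `[0, +oo[) h x.
  apply: eq_Rintegral => x; rewrite inE /= in_itv /= andbT => x0.
  by rewrite /h ger0_norm.
have cr : continuous (fun x : R => `|x| / (`|x| + 1)).
  move=> x; apply: cvgM; first by apply: cvg_norm; exact: cvg_id.
  apply: cvgV; first by rewrite gt_eqF // ltr_wpDl.
  by apply: cvgD; [apply: cvg_norm; exact: cvg_id|exact: cvg_cst].
apply: mink_integral_estimate.
- by apply: measurable_funX; exact: continuous_measurable_fun.
- move=> x; have x1 : 0 < `|x| + 1 by rewrite ltr_wpDl.
  rewrite /h exprn_ge0 ?divr_ge0 ?(ltW x1) //= exprn_ile1 ?divr_ge0 ?(ltW x1) //.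
  by rewrite ler_pdivrMr // mul1r lerDl.
move=> e e0.
have := kernel_sum_estimate l0 q0 (root4 _) lq1 q1 lq2 e0.
apply: filterS => N H t /andP[t0 t1].
(* Since l^4 = ln 2, the weight 2^-n equals 2^t exp(-l^4 (t + n)). *)
have -> : \sum_(n < N) 2 ^- n * h (t + n%:R) = shift_sum (kernel l k) N t * 2 `^ t.
  rewrite /shift_sum mulr_suml; apply: eq_bigr => n _.
  rewrite /h /kernel /ratio ger0_norm ?addr_ge0 // l4 powR2_expR -mulrA -expRD.
  have -> : - (ln 2 * (t + n%:R)) + ln 2 * t = - (ln 2 * n%:R) :> R by ring.
  by rewrite expRN expRM_natr lnK ?posrE // mulrC.
rewrite -mulrBl normrM (ger0_norm (powR_ge0 _ _)) ler_wpM2r ?powR_ge0 //.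
by apply: H; rewrite t0 ltW.
Qed.

(** The fourth root of 4 pi^2 ln 2 is sqrt 2 * sqrt pi * l, and ln 2 / l^3 = l. *)
Lemma mink_moment_main L :
  (4 * pi ^+ 2 * ln 2) `^ 4^-1 * Psi_mean R
    * L%:R `^ 4^-1 * mink_C R `^ Num.sqrt L%:R =
  amplitude l (root L) * (Num.sqrt pi * root L / l ^+ 3) * (ln 2 * Psi_mean R).
Proof.
have q0 : 0 <= root L by exact: sqrtr_ge0.
rewrite (powR_inv4 q0 (root4 L)) amplitudeE.
rewrite (@powR_inv4 _ (Num.sqrt 2 * Num.sqrt pi * l)); last 2 first.
- by rewrite !mulr_ge0 ?sqrtr_ge0.
- by rewrite !exprMn !(exprM _ 2 2) l2 !sqr_sqrtr ?pi_ge0 ?ltW //; ring.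
rewrite -l4; field; rewrite gt_eqF //.
Qed.

Lemma mink_moment_asymptotics : mink_moment R = (fun L : nat =>
      (4 * pi ^+ 2 * ln 2) `^ 4^-1 * Psi_mean R
        * L%:R `^ 4^-1 * mink_C R `^ Num.sqrt L%:R)
    +O_\oo (fun L : nat => L%:R `^ (- 4^-1) * mink_C R `^ Num.sqrt L%:R).
Proof.
apply/eqaddOP.
pose K : R := estimate_const l * Num.sqrt 2 * (ln 2 * Psi_mean R).
near=> c; have Kc : K <= c by near: c; apply: nbhs_pinfty_ge; exact: num_real.
have big (M : R) : \forall L \near \oo, M <= root L ^+ 2.
  near=> n; rewrite root2.
  have M2 : M ^+ 2 <= n%:R by near: n; exact: nbhs_infty_ger.
  apply: le_trans (ler_norm M) _.
  by rewrite -sqrtr_sqr ler_sqrt.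
near=> L.
have q0 : 0 <= root L by exact: sqrtr_ge0.
have q1 : 1 <= root L.
  rewrite -(@ler_pXn2r _ 2) ?nnegrE // expr1n.
  by near: L; exact: big.
have lq2 : 2 * l ^+ 2 <= root L ^+ 2 by near: L; exact: big.
have lq1 : 1 <= l * root L.
  rewrite -(@ler_pXn2r _ 2) ?nnegrE ?mulr_ge0 ?(ltW l0) // expr1n exprMn.
  rewrite -ler_pdivrMl ?exprn_gt0 //.
  by near: L; exact: big.
have L2 : (2 <= L)%N by near: L; exact: nbhs_infty_ge.
rewrite [X in `|X|](_ : _ = mink_moment R L -
    amplitude l (root L) * (Num.sqrt pi * root L / l ^+ 3) * (ln 2 * Psi_mean R)); last first.
  by rewrite -mink_moment_main.
(* The estimate is stated for exponents of the form k + 2, so L >= 2 is rewritten that way. *)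
move: q1 lq1 lq2; rewrite -(subnKC L2) addnC addn2 => q1 lq1 lq2.
apply: le_trans (mink_moment_estimate q1 lq1 lq2) _.
set n := (L - 2).+2.
have p : 0 <= n%:R `^ (- 4^-1) * mink_C R `^ Num.sqrt n%:R.
  by rewrite mulr_ge0 ?powR_ge0.
rewrite ger0_norm //; apply: le_trans (ler_wpM2r p Kc).
rewrite powRN (powR_inv4 (sqrtr_ge0 _) (root4 n)) amplitudeE /K.
by rewrite le_eqVlt; apply/orP; left; apply/eqP; ring.
Unshelve. all: by end_near. Qed.

End moment_asymptotics.

Theorem theorem1 (R : realType) :
  (forall L : nat, mink_moment R L =
     2 * \int[lebesgue_stieltjes_measure (@mink R)]_(x in `[0, 1]) x ^+ L) /\
  mink_moment R = (fun L : nat =>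
      (4 * pi ^+ 2 * ln 2) `^ 4^-1 * Psi_mean R
        * L%:R `^ 4^-1 * mink_C R `^ Num.sqrt L%:R)
    +O_\oo (fun L : nat => L%:R `^ (- 4^-1) * mink_C R `^ Num.sqrt L%:R).
Proof.
by split; [exact: mink_moment_unit_interval|exact: mink_moment_asymptotics].
Qed.
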